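(* Let $I=(x_1,\dots,x_n)^d\subset S=k[x_1,\dots,x_n]$, let $m$ be a monomial of degree $d$ with $|\mathrm{supp}(m)|=s>1$, and let $\widehat I$ be the ideal generated by all monomials of degree $d$ except $m$. Then the graded Betti numbers of $S/\widehat I$ are given by $$\beta_{0,0}(S/\widehat I)=1,$$ $$\beta_{p,d+p-1}(S/\widehat I)=\beta_{p,d+p-1}(S/I)-\binom{n}{p-1}+\binom{n-s}{n-p+1},$$ $$\beta_{p,d+p}(S/\widehat I)=\binom{n-s}{n-p},$$ and $\beta_{p,q}(S/\widehat I)=0$ otherwise. The Poincaré polynomial $P_{S/\widehat I}(t,u)=\sum_{p,q}\beta_{p,q}(S/\widehat I)t^pu^q$ is given by $$P_{S/\widehat I}(t,u)=P_{S/I}(t,u)-tu^d(1+tu)^n+(1+t)t^{s}u^{s+d}(1+tu)^{n-s}.$$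
   Context: $k$ is a field. $\mathrm{supp}(m)=\{i: x_i\text{ divides }m\}$. $\beta_{p,q}(M)=\dim_k \mathrm{Tor}^S_p(M,k)_q$ denotes the graded Betti number of $M$ in homological degree $p$ and internal degree $q$. $P_{S/I}(t,u)=\sum_{p,q}\beta_{p,q}(S/I)t^pu^q$. Binomial coefficients $\binom{a}{b}$ are $0$ when $b<0$ or $b>a$. *)

(* Defs.v *)
From HB Require Import structures.
From Stdlib Require Import ClassicalEpsilon.
From mathcomp Require Import all_boot all_order all_algebra.
From mathcomp Require Export mpoly.

Set Implicit Arguments.
Unset Strict Implicit.
Unset Printing Implicit Defensive.
Import GRing.Theory.
Local Open Scope ring_scope.

Section Ideals.
Variables (k : fieldType) (n : nat).
Notation S := {mpoly k[n]}.

Definition ideal_gen (G : S -> Prop) (f : S) : Prop :=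
  exists2 r : seq (S * S),
    (forall cg, cg \in r -> G cg.2) & f = \sum_(cg <- r) cg.1 * cg.2.

Definition ideal_pow (J : S -> Prop) (d : nat) : S -> Prop :=
  ideal_gen (fun f => exists2 g : 'I_d -> S,
    (forall i, J (g i)) & f = \prod_(i < d) g i).

Definition var_ideal : S -> Prop :=
  ideal_gen (fun f => exists i : 'I_n, f = 'X_i).

Definition monomials_except_ideal (d : nat) (m : 'X_{1..n}) : S -> Prop :=
  ideal_gen (fun f => exists m' : 'X_{1..n},
    [/\ mdeg m' = d, m' != m & f = 'X_[m']]).

End Ideals.

(* [(m1 <= m2)%MM] is divisibility of monomials. *)
Definition msupport (n : nat) (m : 'X_{1..n}) : {set 'I_n} :=
  [set i | (U_(i) <= m)%MM].

Section Betti.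
Variables (k : fieldType) (n : nat).
Notation S := {mpoly k[n]}.

(* A sequence ... -> F_2 -> F_1 -> F_0 of graded free S-modules of finite     *)
(* rank, with a map from F_0 to S. The module F_p is the space of row vectors *)
(* of length [frank p], whose i-th basis vector has degree [fdeg p i], i.e.,  *)
(* F_p is the direct sum of the S(- fdeg p i). Maps act by right              *)
(* multiplication: [fdiff p] goes from F_(p+1) to F_p. *)
Record free_chain := FreeChain {
  frank : nat -> nat;
  fdeg : forall p, 'I_(frank p) -> int;
  fdiff : forall p, 'M[S]_(frank p.+1, frank p);
  faug : 'cV[S]_(frank 0)
}.

Definition homog_int (e : int) (f : S) : Prop :=
  if e is Posz j then f \is j.-homog else f = 0.

(* F is a graded free resolution of S/I: all maps are homogeneous of degree 0 *)
(* and ... -> F_1 -> F_0 -> S/I -> 0 is exact, where F_0 -> S/I is [faug]     *)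
(* followed by the projection. *)
Definition resolution (I : S -> Prop) (F : free_chain) : Prop :=
  [/\ forall i, homog_int (fdeg i) (faug F i 0),
      forall p (i : 'I_(frank F p.+1)) (j : 'I_(frank F p)),
        homog_int (fdeg i - fdeg j) (fdiff F p i j),
      forall f : S, exists v : 'rV[S]_(frank F 0),
        I (f - (v *m faug F) 0 0),
      forall v : 'rV[S]_(frank F 0),
        I ((v *m faug F) 0 0) <-> exists w, v = w *m fdiff F 0
    & forall p (v : 'rV[S]_(frank F p.+1)),
        v *m fdiff F p = 0 <-> exists w, v = w *m fdiff F p.+1].

(* Here k is the S-module S/(x_1, ..., x_n), so that F_p (x) k is the space   *)
(* of row vectors over k of length [frank p], and the differential of F (x) k *)
(* is given by the constant terms of the entries of [fdiff]. *)
Definition tdiff (F : free_chain) p : 'M[k]_(frank F p.+1, frank F p) :=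
  map_mx (mcoeff 0%MM) (fdiff F p).

(* Subspaces of F_p (x) k are represented as row spaces of matrices. *)
Definition tdeg (F : free_chain) p (q : int) : 'M[k]_(frank F p) :=
  diag_mx (\row_i (fdeg (f := F) i == q)%:R).

Definition tcycles (F : free_chain) p (q : int) : 'M[k]_(frank F p) :=
  match p return 'M[k]_(frank F p) with
  | 0%N => tdeg F 0 q
  | p'.+1 => (tdeg F p'.+1 q :&: kermx (tdiff F p'))%MS
  end.

Definition tboundaries (F : free_chain) p (q : int) :
    'M[k]_(frank F p.+1, frank F p) :=
  tdeg F p.+1 q *m tdiff F p.

(* The dimension of the degree q part of H_p(F (x) k). The subtraction is not *)
(* truncated when F is a complex, as the boundaries are then cycles. *)
Definition thomology_dim (F : free_chain) p (q : int) : nat :=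
  (\rank (tcycles F p q) - \rank (tboundaries F p q))%N.

(* The graded Betti number dim_k Tor^S_p(S/I, k)_q, for I homogeneous: Tor is *)
(* the homology of F (x) k for a graded free resolution F of S/I, and all     *)
(* choices of F give the same dimensions. *)
Definition betti (I : S -> Prop) (p : nat) (q : int) : nat :=
  epsilon (inhabits 0%N)
    (fun b => exists2 F, resolution I F & b = thomology_dim F p q).

(* P is the sum of the betti I p q t^p u^q, a polynomial in t over Z[u]; in   *)
(* particular only finitely many of these numbers are nonzero, and none with  *)
(* q < 0. *)
Definition poincare_poly (I : S -> Prop) (P : {poly {poly int}}) : Prop :=
  forall (p : nat) (q : int),
    (betti I p q)%:Z = if q is Posz j then P`_p`_j else 0.

End Betti.

Definition binz (a b : int) : int :=
  if (0 <= b <= a)%R then 'C(`|a|%N, `|b|%N)%:Z else 0.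

(* Main.v *)
From Stdlib Require Import ClassicalEpsilon.
Require Import Defs.
From mathcomp Require Import all_boot all_order all_algebra.
From mathcomp Require Import ring zify.

Set Implicit Arguments.
Unset Strict Implicit.
Unset Printing Implicit Defensive.
Import GRing.Theory.
Local Open Scope ring_scope.

(** The graded Betti numbers of S/J are the dimensions of the graded pieces of
Tor^S(S/J, k), and Tor is balanced: instead of resolving S/J one may resolve k,
by the Koszul complex K of x_1, ..., x_n. So beta_{p,q}(S/J) is the dimension
of the degree q part of H_p(K (x) S/J). As K_p is free on the p-subsets of the
variables, all of degree p, the piece of degree q is made of forms of degree
e = q - p. Both ideals contain every monomial of degree > d and none of degree
< d, which leaves few cases.
 - If e > d, or if e = d and J = I, then S/J vanishes in degree e (koszul_top).
 - If e < d - 1, cycles modulo J are honest cycles of K, which is exact; only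
   the class of 1 at p = q = 0 survives (koszul_acyclic, koszul_00).
 - If e = d and J is the ideal without m, then S/J in degree d is the line
   spanned by m, so K_p (x) S/J has a basis m e_U, with U of size p, all of
   them cycles. The boundary of (m/x_j) e_{U + j} is m e_U up to sign when x_j
   divides m and j is not in U, its other terms being in J; hence exactly the
   m e_U with supp(m) contained in U survive (koszul_socle), and there are
   binomial(n-s, n-p) of them.
 - If e = d - 1, boundaries are the same for I and for the ideal without m, and
   everything is a cycle for I. A chain is a cycle for the smaller ideal when m
   has coefficient 0 in its boundary. By the previous computation this imposes
   as many independent conditions as there are (p-1)-subsets that do not
   contain supp(m), whence beta_p(S/I) exceeds the other Betti number by
   binomial(n, p-1) - binomial(n-s, n-p+1) (koszul_linear).
The Poincare polynomial is the generating function of these values.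

Two general facts support this computation. Balancing (quotient_dim_balance)
is a chase through the double complex G (x) F, one staircase step at a time,
for arbitrary resolutions F and G; applied to K it also shows that the
dimension does not depend on the resolution F of S/J. The Taylor resolution of
a monomial ideal (taylor_resolution) shows that a resolution of finite rank
exists; for the ideal (x_1, ..., x_n) it is the Koszul complex, so it also
gives the exactness of K. *)

(** * Dimensions of subquotients *)

Section QuotientDimension.
Variables (k : fieldType) (n : nat).
Notation S := {mpoly k[n]}.

(** Modules over S are regarded as k-spaces through the constants [c%:MP]. *)
Definition subspace (V : lmodType S) (Z : V -> Prop) : Prop :=
  Z 0 /\ forall c x y, Z x -> Z y -> Z (c%:MP *: x + y).

Definition linear_rel (V : lmodType S) (r : nat)
    (rho : V -> 'rV[k]_r -> Prop) : Prop :=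
  forall c x y u v, rho x u -> rho y v -> rho (c%:MP *: x + y) (c *: u + v).

(** The isomorphism from Z/B to k^r is a relation rather than a map: this lets it
be composed with the correspondences of a diagram chase, where representatives
are not unique, and V may have infinite dimension. *)
Definition quotient_dim (V : lmodType S) (Z B : V -> Prop) (r : nat) : Prop :=
  exists rho : V -> 'rV[k]_r -> Prop,
    [/\ linear_rel rho,
        forall x, Z x <-> exists u, rho x u,
        forall u, exists x, rho x u
      & forall x u, rho x u -> (B x <-> u = 0)].

Section SubspaceTheory.
Variable V : lmodType S.
Implicit Types Z : V -> Prop.

Lemma subspace0 Z : subspace Z -> Z 0. Proof. by case. Qed.

Lemma subspaceD Z x y : subspace Z -> Z x -> Z y -> Z (x + y).
Proof. by case=> _ Zl Zx Zy; have := Zl 1 x y Zx Zy; rewrite mpolyC1 scale1r. Qed.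

Lemma subspaceZ Z c x : subspace Z -> Z x -> Z (c%:MP *: x).
Proof. by case=> Z0 Zl Zx; have := Zl c x 0 Zx Z0; rewrite addr0. Qed.

Lemma subspaceN Z x : subspace Z -> Z x -> Z (- x).
Proof.
by move=> sZ /(subspaceZ (- 1) sZ); rewrite mpolyCN mpolyC1 scaleN1r.
Qed.

Lemma subspaceB Z x y : subspace Z -> Z x -> Z y -> Z (x - y).
Proof. by move=> sZ Zx /(subspaceN sZ); apply: subspaceD. Qed.

Lemma subspace_sum Z (I : Type) (s : seq I) (P : pred I) (F : I -> V) :
  subspace Z -> (forall i, P i -> Z (F i)) -> Z (\sum_(i <- s | P i) F i).
Proof.
move=> sZ ZF; apply: big_ind => //; first exact: subspace0.
by move=> x y; apply: subspaceD.
Qed.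

Lemma subspaceI Z Z' : subspace Z -> subspace Z' ->
  subspace (fun x => Z x /\ Z' x).
Proof.
move=> sZ sZ'; split; first by split; apply: subspace0.
by move=> c x y [? ?] [? ?]; split; apply: subspaceD => //; apply: subspaceZ.
Qed.

End SubspaceTheory.

Lemma linear_rel0 (V : lmodType S) r (rho : V -> 'rV[k]_r -> Prop) x u :
  linear_rel rho -> rho x u -> rho 0 0.
Proof.
move=> lr h; have := lr (- 1) _ _ _ _ h h.
by rewrite mpolyCN mpolyC1 !scaleN1r !addNr.
Qed.

Lemma linear_rel_sum (V : lmodType S) r (rho : V -> 'rV[k]_r -> Prop)
    (z : 'I_r -> V) :
  linear_rel rho -> rho 0 0 -> (forall i, rho (z i) (delta_mx 0 i)) ->
  forall u : 'rV[k]_r, rho (\sum_i (u 0 i)%:MP *: z i) u.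
Proof.
move=> lr r0 rz u; rewrite [X in rho _ X]row_sum_delta.
elim: (index_enum _) => [|i s IHs]; first by rewrite !big_nil.
by rewrite !big_cons; apply: lr.
Qed.

(** A correspondence that is total on both sides and matches B with B' induces an
isomorphism of the quotients. *)
Lemma quotient_dim_transfer (V W : lmodType S) (R : V -> W -> Prop)
    (Z B : V -> Prop) (Z' B' : W -> Prop) r :
  (forall c x y x' y', R x x' -> R y y' ->
     R (c%:MP *: x + y) (c%:MP *: x' + y')) ->
  (forall x, Z x <-> exists x', R x x') ->
  (forall x', Z' x' <-> exists x, R x x') ->
  (forall x x', R x x' -> (B x <-> B' x')) ->
  quotient_dim Z B r -> quotient_dim Z' B' r.
Proof.
move=> lR dZ dZ' dB [rho [lr dom surj ker]].
exists (fun x' u => exists2 x, R x x' & rho x u); split.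
- move=> c x' y' u v [x Rx rx] [y Ry ry].
  by exists (c%:MP *: x + y); [apply: lR | apply: lr].
- move=> x'; split=> [/dZ'[x Rx]|[u [x Rx _]]]; last by apply/dZ'; exists x.
  have /dom[u ru]: Z x by apply/dZ; exists x'.
  by exists u, x.
- move=> u; have [x rx] := surj u.
  have /dZ[x' Rx]: Z x by apply/dom; exists u.
  by exists x', x.
- by move=> x' u [x Rx rx]; rewrite -(dB _ _ Rx); apply: ker.
Qed.

Lemma quotient_dim_ext (V : lmodType S) (Z B Z' B' : V -> Prop) r :
  (forall x, Z x <-> Z' x) -> (forall x, Z x -> (B x <-> B' x)) ->
  quotient_dim Z B r -> quotient_dim Z' B' r.
Proof.
move=> eZ eB [rho [lr dom surj ker]]; exists rho; split=> //.
- by move=> x; rewrite -eZ.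
- move=> x u rx; rewrite -eB; first exact: ker.
  by apply/dom; exists u.
Qed.

(** Lifting the basis of k^r to Z and reading the lifts in k^s gives an r x s
matrix; a combination that it kills lies in B, so the matrix has full row rank. *)
Lemma quotient_dim_leq (V : lmodType S) (Z B : V -> Prop) r s :
  quotient_dim Z B r -> quotient_dim Z B s -> (r <= s)%N.
Proof.
move=> [rho [lr dom surj ker]] [sig [ls doms surjs kers]].
have lift i : exists z, rho z (delta_mx 0 i) by apply: surj.
have [z rz] := fin_all_exists lift.
have liftA i : exists u, sig (z i) u.
  by apply/doms/dom; exists (delta_mx 0 i).
have [a sa] := fin_all_exists liftA.
have [x0 rx0] := surj 0; have r00 := linear_rel0 lr rx0.
have [y0 sy0] := surjs 0; have s00 := linear_rel0 ls sy0.
pose A : 'M[k]_(r, s) := \matrix_i a i.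
have sigA (u : 'rV[k]_r) : sig (\sum_i (u 0 i)%:MP *: z i) (u *m A).
  rewrite mulmx_sum_row; under [X in sig _ X]eq_bigr => i _ do rewrite rowK.
  elim: (index_enum _) => [|i t IHt]; first by rewrite !big_nil.
  by rewrite !big_cons; apply: ls.
suff: row_free A by move/eqP <-; apply: rank_leq_col.
rewrite -kermx_eq0; apply/rowV0P => u /sub_kermxP uA0.
apply/(ker _ _ (linear_rel_sum lr r00 rz u))/(kers _ _ (sigA u)).
exact: uA0.
Qed.

Lemma quotient_dim_uniq (V : lmodType S) (Z B : V -> Prop) r s :
  quotient_dim Z B r -> quotient_dim Z B s -> r = s.
Proof.
by move=> qr qs; apply/eqP; rewrite eqn_leq !(quotient_dim_leq (Z := Z) (B := B)).
Qed.

(** Lifts of a basis of A/B split the exact sequence 0 -> B/C -> A/C -> A/B -> 0. *)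
Lemma quotient_dim_add (V : lmodType S) (A B C : V -> Prop) r s :
  (forall x, C x -> B x) -> (forall x, B x -> A x) ->
  quotient_dim A B r -> quotient_dim B C s -> quotient_dim A C (r + s).
Proof.
move=> CB BA [rho [lr dom surj ker]] [sig [ls doms surjs kers]].
have lift i : exists z, rho z (delta_mx 0 i) by apply: surj.
have [z rz] := fin_all_exists lift.
have [x0 rx0] := surj 0; have r00 := linear_rel0 lr rx0.
pose lc (u : 'rV[k]_r) := \sum_i (u 0 i)%:MP *: z i.
have rlc u : rho (lc u) u by apply: linear_rel_sum.
have lcP c u v : lc (c *: u + v) = c%:MP *: lc u + lc v.
  rewrite scaler_sumr -big_split; apply: eq_bigr => i _ /=.
  by rewrite !mxE mpolyCD mpolyCM scalerDl scalerA.
have B_rho x : B x -> rho x 0.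
  by move=> Bx; have /dom[u ru] := BA _ Bx; have /ker/iffLR/(_ Bx) <- := ru.
exists (fun x u => rho x (lsubmx u) /\ sig (x - lc (lsubmx u)) (rsubmx u)).
split.
- move=> c x y u v [rx sx] [ry sy]; split.
    by rewrite !linearP; apply: lr.
  rewrite !linearP lcP /=.
  have -> : c%:MP *: x + y - (c%:MP *: lc (lsubmx u) + lc (lsubmx v)) =
            c%:MP *: (x - lc (lsubmx u)) + (y - lc (lsubmx v)).
    by rewrite scalerBr opprD addrACA.
  exact: ls.
- move=> x; split=> [/dom[u ru]|[u [ru _]]]; last by apply/dom; exists (lsubmx u).
  have r0 : rho (x - lc u) 0.
    have := lr (- 1) _ _ _ _ (rlc u) ru.
    by rewrite mpolyCN mpolyC1 !scaleN1r addNr addrC.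
  have /doms[v sv]: B (x - lc u) by apply/(ker _ _ r0).
  by exists (row_mx u v); rewrite row_mxKl row_mxKr.
- move=> u; have [y sy] := surjs (rsubmx u).
  have By : B y by apply/doms; exists (rsubmx u).
  exists (lc (lsubmx u) + y); split; last by rewrite addrAC subrr add0r.
  have := lr 1 _ _ _ _ (rlc (lsubmx u)) (B_rho _ By).
  by rewrite mpolyC1 !scale1r addr0.
- move=> x u [rx sx]; split=> [Cx|u0].
    have l0 : lsubmx u = 0 by apply/(ker _ _ rx)/CB.
    move: sx; rewrite l0.
    have -> : lc 0 = 0.
      by rewrite /lc big1 // => i _; rewrite mxE mpolyC0 scale0r.
    rewrite subr0 => /kers/iffLR/(_ Cx) r0.
    by rewrite -[u]hsubmxK l0 r0 row_mx0.
  move: sx; rewrite u0 !linear0.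
  have -> : lc 0 = 0.
    by rewrite /lc big1 // => i _; rewrite mxE mpolyC0 scale0r.
  by rewrite subr0 => /kers ->.
Qed.

(** The usual way to compute a dimension: linear forms indexed by A that cut out B
in Z and admit a dual family in Z. *)
Lemma quotient_dim_coords (V : lmodType S) (T : finType) (A : {set T})
    (Z B : V -> Prop) (F : V -> T -> k) :
  subspace Z ->
  (forall c x y t, F (c%:MP *: x + y) t = c * F x t + F y t) ->
  (forall t, t \in A ->
     exists2 x, Z x & forall t', t' \in A -> F x t' = (t' == t)%:R) ->
  (forall x, Z x -> (B x <-> forall t, t \in A -> F x t = 0)) ->
  quotient_dim Z B #|A|.
Proof.
move=> sZ lF surj ker.
have lin : linear_rel
    (fun x u => Z x /\ u = \row_(i < #|A|) F x (enum_val i)).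
  move=> c x y u v [Zx ->] [Zy ->]; split; first by case: sZ => _; apply.
  by apply/rowP => i; rewrite !mxE lF.
exists (fun x u => Z x /\ u = \row_(i < #|A|) F x (enum_val i)); split=> //.
- by move=> x; split=> [Zx|[u []] //]; exists (\row_i F x (enum_val i)).
- move=> u.
  have lift (i : 'I_#|A|) : exists x, Z x /\
      delta_mx 0 i = \row_(i < #|A|) F x (enum_val i).
    have [x Zx Fx] := surj _ (enum_valP i); exists x; split=> //.
    apply/rowP => j; rewrite !mxE /= Fx ?enum_valP //.
    by rewrite (inj_eq enum_val_inj).
  have [z rz] := fin_all_exists lift.
  exists (\sum_i (u 0 i)%:MP *: z i); apply: (linear_rel_sum lin) => //.
  split; first exact: subspace0.
  apply/rowP => i; rewrite !mxE.
  have := lF (- 1) 0 0 (enum_val i).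
  by rewrite scaler0 addr0 mulN1r addNr.
- move=> x u [Zx ->]; rewrite (ker _ Zx); split=> [F0|/rowP F0 t At].
    by apply/rowP => i; rewrite !mxE F0 ?enum_valP.
  by have := F0 (enum_rank_in At t); rewrite !mxE enum_rankK_in.
Qed.

Lemma quotient_dim0 (V : lmodType S) (Z B : V -> Prop) :
  subspace Z -> (forall x, Z x -> B x) -> quotient_dim Z B 0.
Proof.
move=> sZ ZB; rewrite -(cards0 'I_0).
apply: (@quotient_dim_coords V _ _ Z B (fun _ _ => 0)) => // [c x y t|t|x Zx].
- by rewrite mulr0 addr0.
- by rewrite inE.
- by split=> // _; apply: ZB.
Qed.

End QuotientDimension.

(** * Homogeneous components and monomial ideals *)

Section Graded.
Variables (k : fieldType) (n : nat).
Notation S := {mpoly k[n]}.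
Implicit Types (f g : S) (e : int) (a : 'X_{1..n}).

Lemma homog_intP e f :
  homog_int e f <-> forall a, f@_a != 0 -> (mdeg a)%:Z = e.
Proof.
case: e => [j|j] /=; split.
- by move/dhomogP=> h a; rewrite -mcoeff_msupp => /h /= ->.
- move=> h; apply/dhomogP => a; rewrite mcoeff_msupp => /h.
  by case.
- by move=> -> a; rewrite mcoeff0 eqxx.
- by move=> h; apply/mpolyP => a; rewrite mcoeff0; apply/eqP/negPn/negP => /h.
Qed.

Definition homog_part e f : S := if e is Posz j then pihomog mdeg j f else 0.

Lemma mcoeff_homog_part e f a :
  (homog_part e f)@_a = if (mdeg a)%:Z == e then f@_a else 0.
Proof.
case: e => [j|j] /=; last by rewrite mcoeff0.
rewrite pihomogE raddf_sum /= eqz_nat.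
under eq_bigr => m _ do rewrite mcoeffZ mcoeffX.
have fE : f@_a = \sum_(m <- msupp f) f@_m * (m == a)%:R.
  rewrite [in LHS](mpolyE f) raddf_sum /=; apply: eq_bigr => m _.
  by rewrite mcoeffZ mcoeffX.
case: eqP => [da|/eqP da]; last first.
  rewrite big1 // => m /eqP dm; case: (m =P a) => [ma|_]; last by rewrite mulr0.
  by rewrite -ma dm eqxx in da.
rewrite fE big_mkcond /=; apply: eq_bigr => m _; case: ifP => // /negbT dm.
by case: (m =P a) => [ma|_]; [rewrite ma da eqxx in dm | rewrite mulr0].
Qed.

Lemma homog_part_homog e f : homog_int e (homog_part e f).
Proof.
by apply/homog_intP => a; rewrite mcoeff_homog_part; case: (_ =P e) => // _;
  rewrite eqxx.
Qed.

Lemma homog_part_id e f : homog_int e f -> homog_part e f = f.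
Proof.
move/homog_intP => h; apply/mpolyP => a; rewrite mcoeff_homog_part.
case: eqP => // ne; apply/esym/eqP/negPn/negP => /h; exact: ne.
Qed.

Lemma homog_partB e f g : homog_part e (f - g) = homog_part e f - homog_part e g.
Proof.
apply/mpolyP => a; rewrite mcoeffB !mcoeff_homog_part mcoeffB.
by case: ifP => // _; rewrite subr0.
Qed.

Lemma homog_part_sum e (I : Type) (s : seq I) (F : I -> S) :
  homog_part e (\sum_(i <- s) F i) = \sum_(i <- s) homog_part e (F i).
Proof.
apply/mpolyP => a; rewrite mcoeff_homog_part !(raddf_sum (mcoeff a)).
case: ifP => ea; last by rewrite big1 // => i _ /=; rewrite mcoeff_homog_part ea.
by apply: eq_bigr => i _ /=; rewrite mcoeff_homog_part ea.
Qed.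

Lemma homog_partM e e' f g :
  homog_int e' g -> homog_part e (f * g) = homog_part (e - e') f * g.
Proof.
move/homog_intP => h; apply/mpolyP => a; rewrite mcoeff_homog_part !mcoeffM.
case: ifP => [/eqP da|/negbT da].
  apply: eq_bigr => -[b c] /= /eqP abc; rewrite mcoeff_homog_part.
  have [->|/h dc] := eqVneq g@_c 0; first by rewrite !mulr0.
  by rewrite abc mdegD PoszD dc in da; rewrite -da addrK eqxx.
rewrite big1 // => -[b c] /= /eqP abc; rewrite mcoeff_homog_part.
have [->|/h dc] := eqVneq g@_c 0; first by rewrite mulr0.
case: eqP => [db|_]; last by rewrite mul0r.
by case/eqP: da; rewrite abc mdegD PoszD dc db subrK.
Qed.

(** With [dp] and [dr] the degrees of the generators, these are the matrices of the
degree 0 maps between graded free modules. *)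
Definition homog_mx p r (dp : 'I_p -> int) (dr : 'I_r -> int)
    (X : 'M[S]_(p, r)) : Prop :=
  forall i j, homog_int (dp i - dr j) (X i j).

Definition homog_part_mx p r (dp : 'I_p -> int) (dr : 'I_r -> int)
    (X : 'M[S]_(p, r)) : 'M[S]_(p, r) :=
  \matrix_(i, j) homog_part (dp i - dr j) (X i j).

Section Matrices.
Variables (p r : nat) (dp : 'I_p -> int) (dr : 'I_r -> int).
Implicit Types X : 'M[S]_(p, r).

Lemma homog_mx_subspace : subspace (homog_mx dp dr).
Proof.
split=> [i j|c X Y hX hY i j]; apply/homog_intP => a.
  by rewrite mxE mcoeff0 eqxx.
rewrite !mxE mcoeffD mcoeffCM.
have /homog_intP/(_ a) := hX i j; have /homog_intP/(_ a) := hY i j.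
case: (eqVneq (Y i j)@_a 0) => [->|_ /(_ isT)] //.
case: (eqVneq (X i j)@_a 0) => [->|_ _ /(_ isT)] //.
by rewrite mulr0 addr0 eqxx.
Qed.

Lemma homog_part_mx_homog X : homog_mx dp dr (homog_part_mx dp dr X).
Proof. by move=> i j; rewrite mxE; apply: homog_part_homog. Qed.

Lemma homog_part_mx_id X : homog_mx dp dr X -> homog_part_mx dp dr X = X.
Proof. by move=> h; apply/matrixP => i j; rewrite mxE homog_part_id. Qed.

Lemma homog_part_mxB X Y :
  homog_part_mx dp dr (X - Y) = homog_part_mx dp dr X - homog_part_mx dp dr Y.
Proof. by apply/matrixP => i j; rewrite !mxE homog_partB. Qed.

(** Taking components commutes with maps of degree 0. This is what turns exactness
in the ungraded sense into exactness in each degree. *)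
Lemma homog_part_mx_mulr s (ds : 'I_s -> int) X (D : 'M[S]_(r, s)) :
  homog_mx dr ds D -> homog_part_mx dp ds (X *m D) = homog_part_mx dp dr X *m D.
Proof.
move=> hD; apply/matrixP => i j; rewrite !mxE homog_part_sum; apply: eq_bigr => l _.
rewrite !mxE (homog_partM _ _ (hD l j)); congr (homog_part _ _ * _).
by rewrite opprB addrA subrK.
Qed.

Lemma homog_mx_mulr s (ds : 'I_s -> int) X (D : 'M[S]_(r, s)) :
  homog_mx dp dr X -> homog_mx dr ds D -> homog_mx dp ds (X *m D).
Proof.
move=> hX hD; rewrite -(homog_part_mx_id hX) -(homog_part_mx_mulr _ hD) => i j.
by rewrite mxE; apply: homog_part_homog.
Qed.

End Matrices.

Section MonomialIdeal.
Variable P : 'X_{1..n} -> Prop.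

(** When [P] is stable under multiples, this is the ideal spanned by the monomials
in [P]. *)
Definition mon_ideal f : Prop := forall a, f@_a != 0 -> P a.

Definition mon_ideal_mx p r (X : 'M[S]_(p, r)) := forall i j, mon_ideal (X i j).

Lemma mon_ideal0 : mon_ideal 0.
Proof. by move=> a; rewrite mcoeff0 eqxx. Qed.

Lemma mon_idealD f g : mon_ideal f -> mon_ideal g -> mon_ideal (f + g).
Proof.
move=> If Ig a; rewrite mcoeffD.
have [->|/If //] := eqVneq f@_a 0.
by rewrite add0r => /Ig.
Qed.

Lemma mon_ideal_sum (I : Type) (s : seq I) (F : I -> S) :
  (forall i, mon_ideal (F i)) -> mon_ideal (\sum_(i <- s) F i).
Proof. by move=> IF; apply: big_ind => //; [apply: mon_ideal0 | apply: mon_idealD]. Qed.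

Lemma mon_ideal_homog_part e f : mon_ideal f -> mon_ideal (homog_part e f).
Proof.
move=> If a; rewrite mcoeff_homog_part; case: ifP => _; last by rewrite eqxx.
exact: If.
Qed.

Definition upward := forall a b, P a -> P (a + b)%MM.
Hypothesis upP : upward.

Lemma mon_idealM f g : mon_ideal f -> mon_ideal (f * g).
Proof.
move=> If a; rewrite mcoeffM => /eqP nz.
suff [[b c] /= abc /If Pb] :
    exists2 bc : 'X_{1..n < (mdeg a).+1} * 'X_{1..n < (mdeg a).+1},
      a = (bc.1 + bc.2)%MM & f@_bc.1 != 0.
  by rewrite abc; apply: upP.
have [/existsP[bc /andP[/eqP abc fb]]|/existsPn h] :=
  boolP [exists bc : 'X_{1..n < (mdeg a).+1} * 'X_{1..n < (mdeg a).+1},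
      (a == (bc.1 + bc.2)%MM) && (f@_bc.1 != 0)]; first by exists bc.
case: nz; apply: big1 => bc abc; have := h bc; rewrite /= abc /=.
by move=> /negPn/eqP ->; rewrite mul0r.
Qed.

Section Matrices.
Variables (p r : nat).
Implicit Types X Y : 'M[S]_(p, r).

Lemma mon_ideal_mx0 : mon_ideal_mx (0 : 'M[S]_(p, r)).
Proof. by move=> i j; rewrite mxE; apply: mon_ideal0. Qed.

Lemma mon_ideal_mxD X Y : mon_ideal_mx X -> mon_ideal_mx Y -> mon_ideal_mx (X + Y).
Proof. by move=> IX IY i j; rewrite mxE; apply: mon_idealD. Qed.

Lemma mon_ideal_mx_mull s (D : 'M[S]_(s, p)) X :
  mon_ideal_mx X -> mon_ideal_mx (D *m X).
Proof.
move=> IX i j; rewrite mxE; apply: mon_ideal_sum => l.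
by rewrite mulrC; apply: mon_idealM.
Qed.

Lemma mon_ideal_mx_subspace : subspace (@mon_ideal_mx p r).
Proof.
split=> [i j|c X Y IX IY]; first by rewrite mxE; apply: mon_ideal0.
apply: mon_ideal_mxD => // i j; rewrite mxE mulrC; exact: mon_idealM.
Qed.

Lemma mon_ideal_mx_homog_part_mx (dp : 'I_p -> int) (dr : 'I_r -> int) X :
  mon_ideal_mx X -> mon_ideal_mx (homog_part_mx dp dr X).
Proof. by move=> IX i j; rewrite mxE; apply: mon_ideal_homog_part. Qed.

End Matrices.
End MonomialIdeal.

Section ResolutionTheory.
Variables (P : 'X_{1..n} -> Prop) (J : S -> Prop) (F : free_chain k n).
Hypothesis JP : forall f, J f <-> mon_ideal P f.
Hypothesis resF : resolution J F.

Lemma fdiff_homog_mx p : homog_mx (fdeg (p := p.+1)) (fdeg (p := p)) (fdiff F p).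
Proof. by case: resF => _ h _ _ _ i j; apply: h. Qed.

Lemma faug_homog_mx : homog_mx (fdeg (p := 0)) (fun=> 0) (faug F).
Proof. by case: resF => h _ _ _ _ i j; rewrite subr0 (ord1 j); apply: h. Qed.

Lemma fdiff_mul p : fdiff F p.+1 *m fdiff F p = 0.
Proof.
case: resF => _ _ _ _ ex; apply/row_matrixP => i.
rewrite row_mul row0; apply/ex; exists (delta_mx 0 i); exact: rowE.
Qed.

Lemma fdiff_aug : mon_ideal_mx P (fdiff F 0 *m faug F).
Proof.
case: resF => _ _ _ ex _ i j; apply/JP.
have -> : (fdiff F 0 *m faug F) i j = (row i (fdiff F 0) *m faug F) 0 0.
  by rewrite -row_mul [RHS]mxE (ord1 j).
by apply/ex; exists (delta_mx 0 i); apply: rowE.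
Qed.

Variables (s : nat) (ds : 'I_s -> int).

(** A preimage is found row by row; its homogeneous component is then a preimage of
the right degree. *)
Lemma exact_fdiff p (X : 'M[S]_(s, frank F p.+1)) :
  homog_mx ds (fdeg (p := _)) X -> X *m fdiff F p = 0 ->
  exists2 W, homog_mx ds (fdeg (p := _)) W & X = W *m fdiff F p.+1.
Proof.
move=> hX X0; case: resF => _ _ _ _ ex.
have rX i : exists w, row i X = w *m fdiff F p.+1.
  by apply/ex; rewrite -row_mul X0 row0.
have [w wX] := fin_all_exists rX.
exists (homog_part_mx ds (fdeg (p := _)) (\matrix_i w i));
  first exact: homog_part_mx_homog.
rewrite -(homog_part_mx_mulr _ _ (@fdiff_homog_mx _)) -[LHS](homog_part_mx_id hX).
congr homog_part_mx.
by apply/row_matrixP => i; rewrite row_mul rowK.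
Qed.

Lemma exact_faug (X : 'M[S]_(s, frank F 0)) :
  homog_mx ds (fdeg (p := _)) X -> mon_ideal_mx P (X *m faug F) ->
  exists2 W, homog_mx ds (fdeg (p := _)) W & X = W *m fdiff F 0.
Proof.
move=> hX X0; case: resF => _ _ _ ex _.
have rX i : exists w, row i X = w *m fdiff F 0.
  by apply/ex/JP; rewrite -row_mul mxE; apply: X0.
have [w wX] := fin_all_exists rX.
exists (homog_part_mx ds (fdeg (p := _)) (\matrix_i w i));
  first exact: homog_part_mx_homog.
rewrite -(homog_part_mx_mulr _ _ (@fdiff_homog_mx _)) -[LHS](homog_part_mx_id hX).
congr homog_part_mx.
by apply/row_matrixP => i; rewrite row_mul rowK.
Qed.

Lemma surj_faug (Y : 'cV[S]_s) :
  homog_mx ds (fun=> 0) Y ->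
  exists2 X, homog_mx ds (fdeg (p := _)) X & mon_ideal_mx P (Y - X *m faug F).
Proof.
move=> hY; case: resF => _ _ sur _ _.
have rY i : exists v : 'rV_(frank F 0), J (Y i 0 - (v *m faug F) 0 0).
  exact: sur.
have [v vY] := fin_all_exists rY.
exists (homog_part_mx ds (fdeg (p := _)) (\matrix_i v i));
  first exact: homog_part_mx_homog.
rewrite -(homog_part_mx_mulr _ _ (@faug_homog_mx)) -[Y](homog_part_mx_id hY).
rewrite -homog_part_mxB.
apply: mon_ideal_mx_homog_part_mx => i j; rewrite (ord1 j); apply/JP.
have := vY i; rewrite !mxE; congr (J (_ - _)).
by apply: eq_bigr => l _; rewrite !mxE.
Qed.

End ResolutionTheory.

End Graded.

(** * Balancing Tor *)

Section Balance.
Variables (k : fieldType) (n : nat) (q : int).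
Notation S := {mpoly k[n]}.
Notation chain := (free_chain k n).

Definition codeg (G : chain) a (i : 'I_(frank G a)) : int := q - fdeg i.

Section Double.
Variables (G F : chain).

(** The degree q part of the tensor product of G_a and F_b. The differential of F
acts by right multiplication and that of G by left multiplication with the
transpose, so the squares of the double complex commute because the product of
matrices is associative, and no signs are needed. *)
Definition bihom a b (X : 'M[S]_(frank G a, frank F b)) : Prop :=
  homog_mx (@codeg G a) (@fdeg _ _ F b) X.

(** Modulo [biboundary], these are the classes at position (a, b+1) of the elements
whose horizontal differential is a vertical boundary; [vcycle] exchanges the
two directions. Both compute Tor_{a+b+1}(S/I, S/J). *)
Definition hcycle a b (X : 'M[S]_(frank G a, frank F b.+1)) : Prop :=
  bihom X /\ exists2 Y, bihom Y & X *m fdiff F b = (fdiff G a)^T *m Y.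

Definition vcycle a b (Y : 'M[S]_(frank G a.+1, frank F b)) : Prop :=
  bihom Y /\ exists2 X, bihom X & X *m fdiff F b = (fdiff G a)^T *m Y.

Definition biboundary a b (X : 'M[S]_(frank G a, frank F b)) : Prop :=
  exists X' Y', [/\ bihom X', bihom Y' &
    X = X' *m fdiff F b + (fdiff G a)^T *m Y'].

Lemma bihom_subspace a b : subspace (@bihom a b).
Proof. exact: homog_mx_subspace. Qed.

End Double.

Lemma bihom_tr (G F : chain) a b (X : 'M[S]_(frank G a, frank F b)) :
  bihom X -> bihom (G := F) (F := G) X^T.
Proof. by move=> h i j; rewrite mxE /codeg addrAC; apply: h. Qed.

Lemma hcycle_tr (G F : chain) a b (X : 'M[S]_(frank G a, frank F b.+1)) :
  hcycle X -> vcycle (G := F) (F := G) X^T.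
Proof.
move=> [hX [Y hY XY]]; split; first exact: bihom_tr.
exists Y^T; first exact: bihom_tr.
by apply: trmx_inj; rewrite !trmx_mul !trmxK.
Qed.

Lemma vcycle_tr (G F : chain) a b (X : 'M[S]_(frank G a.+1, frank F b)) :
  vcycle X -> hcycle (G := F) (F := G) X^T.
Proof.
move=> [hX [Y hY XY]]; split; first exact: bihom_tr.
exists Y^T; first exact: bihom_tr.
by apply: trmx_inj; rewrite !trmx_mul !trmxK.
Qed.

Lemma biboundary_tr (G F : chain) a b (X : 'M[S]_(frank G a, frank F b)) :
  biboundary X -> biboundary (G := F) (F := G) X^T.
Proof.
move=> [X' [Y' [hX' hY' ->]]]; exists Y'^T, X'^T; split; try exact: bihom_tr.
by rewrite linearD /= !trmx_mul trmxK addrC.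
Qed.

Section Rows.
Variables (J : S -> Prop) (G F : chain).
Hypothesis resF : resolution J F.

Lemma bihom_mulr a b (X : 'M[S]_(frank G a, frank F b.+1)) :
  bihom X -> bihom (X *m fdiff F b).
Proof. by move=> hX; apply: homog_mx_mulr hX _; apply: fdiff_homog_mx resF _. Qed.

Lemma exact_row a b (X : 'M[S]_(frank G a, frank F b.+1)) :
  bihom X -> X *m fdiff F b = 0 -> exists2 W, bihom W & X = W *m fdiff F b.+1.
Proof. exact: exact_fdiff resF _ _ _ _. Qed.

End Rows.

Section Columns.
Variables (J : S -> Prop) (G F : chain).
Hypothesis resG : resolution J G.

Lemma bihom_mull a b (Y : 'M[S]_(frank G a.+1, frank F b)) :
  bihom Y -> bihom ((fdiff G a)^T *m Y).
Proof.
move=> hY; rewrite -[_ *m Y]trmxK trmx_mul trmxK; apply: bihom_tr.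
by apply: bihom_mulr resG _ _ _ _; apply: bihom_tr.
Qed.

Lemma exact_col a b (Y : 'M[S]_(frank G a.+1, frank F b)) :
  bihom Y -> (fdiff G a)^T *m Y = 0 ->
  exists2 W, bihom W & Y = (fdiff G a.+1)^T *m W.
Proof.
move=> hY Y0.
have [|W hW YW] := exact_row resG (bihom_tr hY).
  by apply: trmx_inj; rewrite trmx_mul trmxK Y0 !linear0.
exists W^T; first exact: bihom_tr.
by apply: trmx_inj; rewrite YW trmx_mul !trmxK.
Qed.

End Columns.

Section Moves.
Variables (I J : S -> Prop) (G F : chain).
Hypotheses (resF : resolution I F) (resG : resolution J G).

(** One step of the staircase: X at (a, b+1) corresponds to Y at (a+1, b) when they
have the same image at (a, b). Exactness of the column through Y and of the row
through X shows that X is a boundary precisely when Y is one. *)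
Lemma quotient_dim_move a b r :
  quotient_dim (@hcycle G F a b) (@biboundary G F a b.+1) r ->
  quotient_dim (@vcycle G F a b) (@biboundary G F a.+1 b) r.
Proof.
apply: (quotient_dim_transfer (R := fun X Y =>
  [/\ bihom X, bihom Y & X *m fdiff F b = (fdiff G a)^T *m Y])).
- move=> c X Y X' Y' [hX hX' XX'] [hY hY' YY']; split.
  + by case: (bihom_subspace G F a b.+1) => _; apply.
  + by case: (bihom_subspace G F a.+1 b) => _; apply.
  + by rewrite mulmxDl mulmxDr -scalemxAl -scalemxAr XX' YY'.
- move=> X; split=> [[hX [Y hY XY]]|[Y [hX hY XY]]]; first by exists Y.
  by split=> //; exists Y.
- move=> X; split=> [[hX [Y hY XY]]|[Y [hX hY XY]]]; first by exists Y.
  by split=> //; exists Y.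
- move=> X Y [hX hY XY]; split=> -[X' [Y' [hX' hY' E]]].
  + have hZ : bihom (Y - Y' *m fdiff F b).
      by apply: subspaceB (bihom_subspace _ _ _ _) hY _; apply: bihom_mulr resF _ _ _ _.
    have [|W hW WE] := exact_col resG hZ.
      rewrite mulmxBr mulmxA -XY E mulmxDl -(mulmxA X') (fdiff_mul resF) mulmx0.
      by rewrite add0r subrr.
    by exists Y', W; split=> //; rewrite -WE addrC subrK.
  + have hZ : bihom (X - (fdiff G a)^T *m X').
      by apply: subspaceB (bihom_subspace _ _ _ _) hX _; apply: bihom_mull resG _ _ _ _.
    have [|W hW WE] := exact_row resF hZ.
      rewrite mulmxBl -mulmxA XY E mulmxDr (mulmxA _ _ Y').
      by rewrite -trmx_mul (fdiff_mul resG) trmx0 mul0mx addr0 subrr.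
    by exists W, X'; split=> //; rewrite -WE subrK.
Qed.

(** If one differential of X is a boundary in the other direction, applying the
other differential to it gives 0, and exactness provides the second condition. *)
Lemma vcycle_hcycle a b (X : 'M[S]_(frank G a.+1, frank F b.+1)) :
  vcycle X <-> hcycle X.
Proof.
split=> -[hX [Y hY XY]]; split=> //.
  have [||W hW WE] := exact_col (G := G) (a := a) (Y := X *m fdiff F b) resG.
  - exact: bihom_mulr resF _ _ _ hX.
  - by rewrite mulmxA -XY -mulmxA (fdiff_mul resF) mulmx0.
  by exists W.
have [||W hW WE] := exact_row (F := F) (b := b) (X := (fdiff G a)^T *m X) resF.
- exact: bihom_mull resG _ _ _ hX.
- by rewrite -mulmxA XY mulmxA -trmx_mul (fdiff_mul resG) trmx0 mul0mx.
by exists W.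
Qed.

Lemma quotient_dim_moves a b r :
  quotient_dim (@hcycle G F a b) (@biboundary G F a b.+1) r ->
  quotient_dim (@vcycle G F (a + b) 0) (@biboundary G F (a + b).+1 0) r.
Proof.
elim: b a => [|b IHb] a /quotient_dim_move; first by rewrite addn0.
move=> h; rewrite -addSnnS; apply: IHb.
by apply: quotient_dim_ext h => // X; apply: vcycle_hcycle.
Qed.

End Moves.

(** The degree q part of the cycles of G (x) S/J, where J is the ideal of [P], and
below of its boundaries, both as subspaces of G_p; all of J G_p consists of
boundaries. *)
Definition cycles_mod (P : 'X_{1..n} -> Prop) (G : chain) p :
    'cV[S]_(frank G p) -> Prop :=
  match p return 'cV[S]_(frank G p) -> Prop with
  | 0 => fun w => homog_mx (@codeg G 0) (fun=> 0) w
  | p'.+1 => fun w => homog_mx (@codeg G p'.+1) (fun=> 0) w /\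
                      mon_ideal_mx P ((fdiff G p')^T *m w)
  end.

Definition boundaries_mod (P : 'X_{1..n} -> Prop) (G : chain) p
    (w : 'cV[S]_(frank G p)) : Prop :=
  exists2 y, homog_mx (@codeg G p.+1) (fun=> 0) y &
             mon_ideal_mx P (w - (fdiff G p)^T *m y).

(** The end of the staircase, in the column of F_0. *)
Definition edge (G F : chain) p : 'M[S]_(frank G p, frank F 0) -> Prop :=
  match p return 'M[S]_(frank G p, frank F 0) -> Prop with
  | 0 => @bihom G F 0 0
  | p'.+1 => @vcycle G F p' 0
  end.

Section Ends.
Variables (PI : 'X_{1..n} -> Prop) (I J : S -> Prop) (G F : chain).
Hypotheses (upI : upward PI) (IP : forall f, I f <-> mon_ideal PI f).
Hypotheses (resF : resolution I F) (resG : resolution J G).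

(** The augmentation of F sends the column of F_0 onto G (x) S/I. *)
Definition endrel p (X : 'M[S]_(frank G p, frank F 0)) (w : 'cV[S]_(frank G p)) :=
  [/\ edge X, cycles_mod PI w & mon_ideal_mx PI (w - X *m faug F)].

Lemma edge_bihom p (X : 'M[S]_(frank G p, frank F 0)) : edge X -> bihom X.
Proof. by case: p X => [|p] X // []. Qed.

Lemma cycles_mod_homog_mx p (w : 'cV[S]_(frank G p)) :
  cycles_mod PI w -> homog_mx (@codeg G p) (fun=> 0) w.
Proof. by case: p w => [|p] X // []. Qed.

Lemma edge_subspace p : subspace (@edge G F p).
Proof.
case: p => [|p]; first exact: bihom_subspace.
split; first by split; [exact: subspace0 (bihom_subspace _ _ _ _)
  | exists 0; [exact: subspace0 (bihom_subspace _ _ _ _) | rewrite mul0mx mulmx0]].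
move=> c X Y [hX [X' hX' XE]] [hY [Y' hY' YE]]; split.
  by case: (bihom_subspace G F p.+1 0) => _; apply.
exists (c%:MP *: X' + Y').
  by case: (bihom_subspace G F p 1) => _; apply.
by rewrite mulmxDl mulmxDr -scalemxAl -scalemxAr XE YE.
Qed.

Lemma cycles_mod_subspace p : subspace (@cycles_mod PI G p).
Proof.
case: p => [|p]; first exact: homog_mx_subspace.
apply: subspaceI; first exact: homog_mx_subspace.
split=> [|c x y Ix Iy]; first by rewrite mulmx0; apply: mon_ideal_mx0.
by rewrite mulmxDr -scalemxAr; apply: (mon_ideal_mx_subspace k upI _ _).2 Ix Iy.
Qed.

(** The vertical differential of X comes from F_1 exactly when its augmentation
lies in I, because F is exact at F_0. *)
Lemma edge_cycles_mod p (X : 'M[S]_(frank G p, frank F 0)) (w : 'cV[S]_(frank G p)) :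
  bihom X -> homog_mx (@codeg G p) (fun=> 0) w -> mon_ideal_mx PI (w - X *m faug F) ->
  (edge X <-> cycles_mod PI w).
Proof.
case: p X w => [|p] X w hX hw wX; first by [].
have vI : mon_ideal_mx PI ((fdiff G p)^T *m w - (fdiff G p)^T *m X *m faug F).
  by rewrite -mulmxA -mulmxBr; apply: mon_ideal_mx_mull.
split=> [[_ [Y hY YX]]|[_ vw]]; split=> //.
  rewrite -[X in mon_ideal_mx _ X](subrK ((fdiff G p)^T *m X *m faug F)).
  apply: mon_ideal_mxD => //; rewrite -YX -mulmxA; apply: mon_ideal_mx_mull => //.
  exact: fdiff_aug IP resF.
have hvX : bihom ((fdiff G p)^T *m X) by apply: bihom_mull resG _ _ _ _.
have [|W hW WE] := exact_faug IP resF hvX; last by exists W.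
rewrite -[X in mon_ideal_mx _ X](subKr ((fdiff G p)^T *m w)).
by apply: subspaceB (mon_ideal_mx_subspace k upI _ _) vw vI.
Qed.

Lemma endrel_bound p (X : 'M[S]_(frank G p, frank F 0)) (w : 'cV[S]_(frank G p)) :
  endrel X w -> (biboundary X <-> boundaries_mod PI w).
Proof.
move=> [/edge_bihom hX /cycles_mod_homog_mx hw wX]; split.
  move=> [X' [Y [hX' hY XE]]]; exists (Y *m faug F).
    by apply: homog_mx_mulr hY _; apply: faug_homog_mx resF.
  have -> : w - (fdiff G p)^T *m (Y *m faug F) =
      (w - X *m faug F) + X' *m (fdiff F 0 *m faug F).
    by rewrite XE mulmxDl !mulmxA opprD addrA [RHS]addrAC subrK.
  apply: mon_ideal_mxD => //; apply: mon_ideal_mx_mull => //.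
  exact: fdiff_aug IP resF.
move=> [y hy wy]; have [Y hY yY] := surj_faug IP resF hy.
have hZ : bihom (X - (fdiff G p)^T *m Y).
  by apply: subspaceB (bihom_subspace _ _ _ _) hX _; apply: bihom_mull resG _ _ _ _.
have [|W hW WE] := exact_faug IP resF hZ; last first.
  by exists W, Y; split=> //; rewrite -WE subrK.
have -> : (X - (fdiff G p)^T *m Y) *m faug F =
    (w - (fdiff G p)^T *m y) - (w - X *m faug F) +
    (fdiff G p)^T *m (y - Y *m faug F).
  rewrite mulmxBl mulmxBr !mulmxA opprB.
  set A := _ *m y; set B := X *m _; set C := _ *m faug F.
  by rewrite [w - A + _]addrC !addrA !subrK.
apply: mon_ideal_mxD; last exact: mon_ideal_mx_mull.
exact: subspaceB (mon_ideal_mx_subspace k upI _ _) wy wX.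
Qed.

Lemma endrel_linear p c (X Y : 'M[S]_(frank G p, frank F 0)) w z :
  endrel X w -> endrel Y z -> endrel (c%:MP *: X + Y) (c%:MP *: w + z).
Proof.
move=> [eX qw wX] [eY qz zY]; split.
- exact: (edge_subspace p).2.
- exact: (cycles_mod_subspace p).2.
- rewrite mulmxDl -scalemxAl opprD addrACA -scalerBr.
  exact: (mon_ideal_mx_subspace k upI _ _).2.
Qed.

Lemma edgeP p (X : 'M[S]_(frank G p, frank F 0)) :
  edge X <-> exists w, endrel X w.
Proof.
split=> [eX|[w []] //]; have hX := edge_bihom eX.
have hw : homog_mx (@codeg G p) (fun=> 0) (X *m faug F).
  by apply: homog_mx_mulr hX _; apply: faug_homog_mx resF.
have wX : mon_ideal_mx PI (X *m faug F - X *m faug F).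
  by rewrite subrr; apply: mon_ideal_mx0.
by exists (X *m faug F); split=> //; apply/(edge_cycles_mod hX hw wX).
Qed.

Lemma cycles_modP p (w : 'cV[S]_(frank G p)) :
  cycles_mod PI w <-> exists X, endrel X w.
Proof.
split=> [qw|[X []] //]; have hw := cycles_mod_homog_mx qw.
have [X hX wX] := surj_faug IP resF hw.
by exists X; split=> //; apply/(edge_cycles_mod hX hw wX).
Qed.

Lemma quotient_dim_edge p r :
  quotient_dim (@edge G F p) (@biboundary G F p 0) r <->
  quotient_dim (@cycles_mod PI G p) (@boundaries_mod PI G p) r.
Proof.
split.
  apply: (quotient_dim_transfer (R := @endrel p)).
  - by move=> c X Y w z; apply: endrel_linear.
  - exact: edgeP.
  - exact: cycles_modP.
  - exact: endrel_bound.
apply: (quotient_dim_transfer (R := fun w X => @endrel p X w)).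
- by move=> c X Y w z; apply: endrel_linear.
- exact: cycles_modP.
- exact: edgeP.
- by move=> w X /endrel_bound ->.
Qed.

End Ends.

(** Balancing: the homologies of F (x) S/J and of G (x) S/I agree in each degree.
The left end of the staircase is the right end for F and G exchanged, which
transposes all matrices. *)
Lemma quotient_dim_balance (PI PJ : 'X_{1..n} -> Prop) (I J : S -> Prop)
    (G F : chain) p r :
  upward PI -> (forall f, I f <-> mon_ideal PI f) -> resolution I F ->
  upward PJ -> (forall f, J f <-> mon_ideal PJ f) -> resolution J G ->
  quotient_dim (@cycles_mod PJ F p) (@boundaries_mod PJ F p) r ->
  quotient_dim (@cycles_mod PI G p) (@boundaries_mod PI G p) r.
Proof.
move=> upI IP resF upJ JP resG /(quotient_dim_edge upJ JP resG resF) h.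
apply/(quotient_dim_edge upI IP resF resG).
have tr a b : (forall c (X Y : 'M[S]_(frank F a, frank G b)) X' Y',
  X' = X^T -> Y' = Y^T -> c%:MP *: X' + Y' = (c%:MP *: X + Y)^T).
  by move=> c X Y X' Y' -> ->; rewrite linearP.
case: p h => [|p] h.
  apply: (quotient_dim_transfer (R := fun X Y => bihom X /\ Y = X^T)) h.
  - move=> c X Y X' Y' [hX ->] [hY ->]; split; last exact: tr.
    exact: (bihom_subspace F G 0 0).2.
  - by move=> X; split=> [hX|[Y []] //]; exists X^T.
  - move=> X; split=> [hX|[Y [hY ->]]]; last exact: bihom_tr.
    by exists X^T; rewrite trmxK; split=> //; apply: bihom_tr.
  - by move=> X Y [_ ->]; split=> /biboundary_tr; rewrite ?trmxK.
apply: (quotient_dim_moves resF resG (a := 0) (b := p)).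
apply: (quotient_dim_transfer (R := fun X Y => vcycle X /\ Y = X^T)) h.
- move=> c X Y X' Y' [hX ->] [hY ->]; split; last exact: tr.
  exact: (edge_subspace F G p.+1).2.
- by move=> X; split=> [hX|[Y []] //]; exists X^T.
- move=> X; split=> [/hcycle_tr hX|[Y [/vcycle_tr hY ->]] //].
  by exists X^T; rewrite trmxK.
- by move=> X Y [_ ->]; split=> /biboundary_tr; rewrite ?trmxK.
Qed.

End Balance.

(** * Tensoring with the residue field *)

Definition mnonzero {n} (a : 'X_{1..n}) : Prop := a != 0%MM.

Section Tor.
Variables (k : fieldType) (n : nat).
Notation S := {mpoly k[n]}.

Lemma mnonzero_upward : upward (@mnonzero n).
Proof. by move=> a b; rewrite /mnonzero mnmD_eq0 negb_and => ->. Qed.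

Lemma mon_ideal_nonzeroP (f : S) : mon_ideal mnonzero f <-> f@_0%MM = 0.
Proof.
split=> [h|f0 a]; last by apply: contra_neq => ->.
by apply/eqP/negPn/negP => /h; rewrite /mnonzero eqxx.
Qed.

Notation ct := (map_mx (mcoeff 0%MM)).

Lemma mon_ideal_mx_nonzeroP p r (X : 'M[S]_(p, r)) :
  mon_ideal_mx mnonzero X <-> ct X = 0.
Proof.
split=> [h|/matrixP h i j].
  by apply/matrixP => i j; rewrite !mxE; apply/mon_ideal_nonzeroP/h.
by apply/mon_ideal_nonzeroP; have := h i j; rewrite !mxE.
Qed.

Variables (I : S -> Prop) (F : free_chain k n) (q : int).
Hypothesis resF : resolution I F.

Lemma sub_tdegP p (v : 'rV[k]_(frank F p)) :
  reflect (forall i, v 0 i != 0 -> fdeg (f := F) i = q) (v <= tdeg F p q)%MS.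
Proof.
apply: (iffP idP) => [/submxP[u ->] i|h].
  rewrite mul_mx_diag !mxE; case: (fdeg i =P q) => // _.
  by rewrite mulr0 eqxx.
apply/submxP; exists v; rewrite mul_mx_diag; apply/rowP => i; rewrite !mxE.
have [->|/h ->] := eqVneq (v 0 i) 0; first by rewrite mul0r.
by rewrite eqxx mulr1.
Qed.

Lemma homog_mx_ct p (w : 'cV[S]_(frank F p)) :
  homog_mx (@codeg k n q F p) (fun=> 0) w -> (ct w^T <= tdeg F p q)%MS.
Proof.
move=> hw; apply/sub_tdegP => i; rewrite !mxE => nz.
have /homog_intP/(_ _ nz) := hw i 0.
by rewrite mdeg0 subr0 => /esym/eqP; rewrite subr_eq0 => /eqP.
Qed.

Definition const_col p (v : 'rV[k]_p) : 'cV[S]_p := \col_i (v 0 i)%:MP.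

Lemma ct_const_col p (v : 'rV[k]_p) : ct (const_col v)^T = v.
Proof. by apply/rowP => i; rewrite !mxE mpolyCK. Qed.

Lemma const_col_homog_mx p (v : 'rV[k]_(frank F p)) :
  (v <= tdeg F p q)%MS -> homog_mx (@codeg k n q F p) (fun=> 0) (const_col v).
Proof.
move=> /sub_tdegP h i j; rewrite !mxE subr0; apply/homog_intP => a.
rewrite mcoeffC; have [->|/h vi] := eqVneq (v 0 i) 0; first by rewrite mul0r eqxx.
have [->|_] := eqVneq a 0%MM; last by rewrite mulr0 eqxx.
by rewrite mdeg0 /codeg vi subrr.
Qed.

Lemma ct_fdiff p (w : 'cV[S]_(frank F p.+1)) :
  ct ((fdiff F p)^T *m w)^T = ct w^T *m tdiff F p.
Proof. by rewrite trmx_mul trmxK map_mxM. Qed.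

Lemma cycles_mod_ct p (w : 'cV[S]_(frank F p)) :
  cycles_mod q mnonzero w <->
  homog_mx (@codeg k n q F p) (fun=> 0) w /\ (ct w^T <= tcycles F p q)%MS.
Proof.
case: p w => [|p] w; first by split=> [hw|[]//]; split=> //; apply: homog_mx_ct.
rewrite /= sub_capmx sub_kermx -ct_fdiff.
split=> [[hw /mon_ideal_mx_nonzeroP w0]|[hw /andP[_ /eqP w0]]].
  by split=> //; rewrite homog_mx_ct // -map_trmx w0 trmx0 eqxx.
by split=> //; apply/mon_ideal_mx_nonzeroP; rewrite -[ct _]trmxK map_trmx w0 trmx0.
Qed.

Lemma boundaries_mod_ct p (w : 'cV[S]_(frank F p)) :
  boundaries_mod q mnonzero w <-> (ct w^T <= tboundaries F p q)%MS.
Proof.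
split=> [[y hy /mon_ideal_mx_nonzeroP wy]|].
  have -> : ct w^T = ct ((fdiff F p)^T *m y)^T.
    by apply: trmx_inj; rewrite -!map_trmx !trmxK; apply/eqP;
      rewrite -subr_eq0 -map_mxB wy.
  by rewrite ct_fdiff submxMr // homog_mx_ct.
move=> /submxP[u uE]; exists (const_col (u *m tdeg F p.+1 q)).
  by apply: const_col_homog_mx; apply: submxMl.
apply/mon_ideal_mx_nonzeroP; apply: trmx_inj; rewrite map_trmx linearB /= map_mxB.
by rewrite ct_fdiff ct_const_col uE mulmxA subrr trmx0.
Qed.

(** This makes the truncated subtraction in [thomology_dim] exact. *)
Lemma tboundaries_cycles p : (tboundaries F p q <= tcycles F p q)%MS.
Proof.
apply/rV_subP => v vB; set w := const_col v.
have [y hy /mon_ideal_mx_nonzeroP wy] : boundaries_mod q mnonzero w.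
  by apply/boundaries_mod_ct; rewrite ct_const_col.
have hDy : homog_mx (@codeg k n q F p) (fun=> 0) ((fdiff F p)^T *m y).
  have hyT : homog_mx (fun=> q) (fdeg (f := F) (p := p.+1)) y^T.
    by move=> i j; rewrite mxE; have := hy j i; rewrite subr0.
  have := homog_mx_mulr hyT (@fdiff_homog_mx _ _ _ _ resF p) => h i j.
  by have := h j i; rewrite -[y^T *m _]trmxK trmx_mul trmxK mxE subr0.
have vE : v = ct ((fdiff F p)^T *m y)^T.
  rewrite -[LHS](ct_const_col) -/w; apply: trmx_inj; rewrite -!map_trmx !trmxK.
  by apply/eqP; rewrite -subr_eq0 -map_mxB wy.
have /cycles_mod_ct[] : cycles_mod q mnonzero ((fdiff F p)^T *m y).
  case: (p) y {wy vE} hy hDy => [|p'] y hy hDy //=; split=> //.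
  apply/mon_ideal_mx_nonzeroP; rewrite mulmxA -trmx_mul (fdiff_mul resF).
  by rewrite trmx0 mul0mx map_mx0.
by rewrite -vE.
Qed.

(** Modulo the variables only constant terms remain, so classes are row vectors
over k; coordinates are taken on a complement of the boundaries in the cycles. *)
Lemma quotient_dim_tor p :
  quotient_dim (@cycles_mod k n q (@mnonzero n) F p)
    (@boundaries_mod k n q (@mnonzero n) F p) (thomology_dim F p q).
Proof.
set C := tcycles F p q; set B := tboundaries F p q.
have rD : \rank (C :\: B)%MS = thomology_dim F p q.
  rewrite /thomology_dim -/C -/B -(mxrank_cap_compl C B).
  by rewrite (capmx_idPr (tboundaries_cycles p)) addKn.
(* The rows of M form a basis of a complement of B in C. *)
rewrite -rD; pose M := row_base (C :\: B)%MS.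
have MC : (M <= C)%MS by rewrite eq_row_base diffmxSl.
have BC := tboundaries_cycles p.
have sub c (x y : 'cV[S]_(frank F p)) : ct (c%:MP *: x + y)^T = c *: ct x^T + ct y^T.
  by apply/rowP => i; rewrite !mxE mcoeffD mcoeffCM.
exists (fun w u => cycles_mod q mnonzero w /\ (ct w^T - u *m M <= B)%MS); split.
- move=> c x y u v [Zx xB] [Zy yB]; split.
    exact: (cycles_mod_subspace q F mnonzero_upward p).2.
  rewrite sub mulmxDl -scalemxAl opprD addrACA -scalerBr.
  by rewrite addmx_sub // scalemx_sub.
- move=> w; split=> [Zw|[u [] //]].
  have /cycles_mod_ct[_ wC] := Zw.
  have : (ct w^T <= (C :\: B) + B)%MS.
    apply: submx_trans wC _; rewrite -(addsmx_diff_cap_eq C B).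
    by rewrite addsmxS // capmxSr.
  move=> /sub_addsmxP[[u1 u2] /= wE].
  have /submxP[u uE] : (u1 *m (C :\: B)%MS <= M)%MS.
    by rewrite eq_row_base submxMl.
  by exists u; split=> //; rewrite -uE wE addrC addKr submxMl.
- move=> u; exists (const_col (u *m M)); rewrite ct_const_col subrr sub0mx; split=> //.
  have uC : (u *m M <= C)%MS by rewrite mulmx_sub.
  apply/cycles_mod_ct; rewrite ct_const_col; split=> //.
  apply: const_col_homog_mx; apply: submx_trans uC _.
  by rewrite /C /tcycles; case: (p) => [|p'] //; apply: capmxSl.
- move=> w u [Zw wB]; rewrite boundaries_mod_ct -/B.
  split=> [cB|u0]; last by move: wB; rewrite u0 mul0mx subr0.
  have uB : (u *m M <= B)%MS.
    by rewrite -[X in (X <= _)%MS](subKr (ct w^T)) addmx_sub // eqmx_opp.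
  have : (u *m M <= (C :\: B) :&: B)%MS.
    by rewrite sub_capmx uB andbT -(eq_row_base (C :\: B)%MS) submxMl.
  rewrite capmx_diff submx0 => /eqP uM0.
  by apply: (row_free_inj (row_base_free (C :\: B)%MS)); rewrite mul0mx.
Qed.

End Tor.

(** * The full simplex is contractible *)

Section Simplex.
Variables (R : comNzRingType) (N : nat).
Implicit Types (T U : {set 'I_N}) (x y z : 'I_N) (c : {set 'I_N} -> R).

Definition sgn x U : R := (-1) ^+ #|[set i in U | (i < x)%N]|.

Lemma sgn_sqr x U : sgn x U * sgn x U = 1.
Proof. by rewrite -expr2 sqrr_sign. Qed.

Lemma sgnU1 x y U : y \notin U -> sgn x (y |: U) = (-1) ^+ (y < x)%N * sgn x U.
Proof.
move=> yU; rewrite /sgn -exprD; congr (_ ^+ _).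
have [yx|xy] := boolP (y < x)%N.
  have -> : [set i in y |: U | (i < x)%N] = y |: [set i in U | (i < x)%N].
    by apply/setP => i; rewrite !inE; case: (i =P y) => [->|]; rewrite ?yx.
  by rewrite cardsU1 inE (negPf yU).
rewrite add0n; apply: eq_card => i; rewrite !inE.
by case: (i =P y) => [->|] //=; rewrite (negPf xy) andbF.
Qed.

Lemma sgnU1id x U : sgn x (x |: U) = sgn x U.
Proof.
congr (_ ^+ _); apply: eq_card => i; rewrite !inE.
by case: (i =P x) => [->|] //=; rewrite ltnn andbF.
Qed.

Lemma sgn_swap x y : x != y ->
  (-1) ^+ (x < y)%N = - (-1) ^+ (y < x)%N :> R.
Proof.
by rewrite -val_eqE /=; case: ltngtP => // _ _; rewrite ?expr1 ?expr0 ?opprK.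
Qed.

(** The coefficient at U of the boundary of the simplicial chain sum_T c(T) T. *)
Definition face_sum c U : R := \sum_(x | x \notin U) sgn x U * c (x |: U).

(** The cone over the chain c with apex z. *)
Definition cone z c T : R := if z \in T then sgn z T * c (T :\ z) else 0.

(** Removing x then y and removing y then x give opposite signs. Terms are
paired instead of divided by 2, as the characteristic is arbitrary. *)
Lemma face_sum_face_sum c U : face_sum (face_sum c) U = 0.
Proof.
pose t x y := sgn x U * sgn y U * (-1) ^+ (x < y)%N * c (y |: (x |: U)).
have -> : face_sum (face_sum c) U =
    \sum_(x | x \notin U) \sum_(y | (y \notin U) && (y != x)) t x y.
  apply: eq_bigr => x xU; rewrite mulr_sumr; apply: eq_big => [y|y yxU].
    by rewrite !inE negb_or andbC.
  by rewrite /t sgnU1 // !mulrA; congr (_ * _); rewrite -!mulrA [_ * sgn y U]mulrC.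
(* The pairs x < y and x > y are then matched by exchanging the sums. *)
rewrite (eq_bigr (fun x => \sum_(y | (y \notin U) && (x < y)%N) t x y +
                         \sum_(y | (y \notin U) && (y < x)%N) t x y)); last first.
  move=> x xU; rewrite (bigID (fun y => (x < y)%N)) /=; congr (_ + _);
    apply: eq_bigl => y; rewrite -andbA -val_eqE; congr (_ && _);
    by case: ltngtP.
rewrite big_split /= [X in _ + X](exchange_big_dep (fun y => y \notin U)) //=;
    last first.
  by move=> x y _ /andP[].
rewrite -big_split big1 //= => x xU.
rewrite [X in _ + X](eq_bigl (fun y => (y \notin U) && (x < y)%N)); last first.
  by move=> y; rewrite xU.
rewrite -big_split big1 //= => y /andP[yU xy].
rewrite /t setUCA sgn_swap; last by rewrite neq_ltn xy.
by rewrite [sgn y U * _]mulrC mulrN mulNr addNr.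
Qed.

(** Coning with apex z is a contracting homotopy. *)
Lemma face_sum_cone z c U : face_sum (cone z c) U + cone z (face_sum c) U = c U.
Proof.
rewrite {2}/cone; case: ifP => zU; last first.
  rewrite addr0 /face_sum (bigD1 z) ?zU //= big1 => [|x /andP[xU xz]].
    rewrite /cone setU11 sgnU1id mulrA sgn_sqr mul1r addr0.
    by rewrite setU1K ?zU.
  by rewrite /cone !inE zU (negPf (_ : z != x)) ?mulr0 // eq_sym.
have UE : U = z |: (U :\ z) by rewrite setD1K.
have zV : z \notin U :\ z by rewrite !inE eqxx.
move: (U :\ z) UE zV => V UE zV.
have -> : face_sum c V = sgn z V * c U + \sum_(x | x \notin U) sgn x V * c (x |: V).
  rewrite /face_sum (bigD1 z) //= -UE; congr (_ + _); apply: eq_bigl => x.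
  by rewrite UE !inE negb_or andbC.
rewrite mulrDr mulrA UE sgnU1id sgn_sqr mul1r -UE.
rewrite addrCA -[RHS]addr0; congr (_ + _).
rewrite mulr_sumr -big_split big1 //= => x xU.
have xz : x != z by apply: contraNneq xU => ->.
have xV : x \notin V by apply: contraNN xU => xV; rewrite UE !inE xV orbT.
rewrite /cone !inE zU orbT.
have -> : (x |: U) :\ z = x |: V.
  apply/setP => i; rewrite UE !inE; case: (i =P z) => [->|] //=.
  by rewrite [z == x]eq_sym (negPf xz) (negPf zV).
rewrite sgnU1 // !mulrA UE sgnU1 // sgnU1id -mulrDl.
rewrite (sgn_swap xz) ; set s := _ ^+ _.
have ss : s * s = 1 by rewrite -expr2 sqrr_sign.
have -> : s * sgn x V * - s * sgn z V = - (s * s) * (sgn z V * sgn x V) by ring.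
by rewrite ss mulN1r addNr mul0r.
Qed.

End Simplex.

(** * The Taylor resolution *)

Section Taylor.
Variables (k : fieldType) (n N : nat) (g : 'I_N -> 'X_{1..n}).
Notation S := {mpoly k[n]}.
Implicit Types (T U : {set 'I_N}) (a b mu : 'X_{1..n}) (v w : {set 'I_N} -> S).

Definition lcmg T : 'X_{1..n} := [multinom \max_(j in T) g j i | i < n].

Lemma lcmgP T mu : reflect (forall j, j \in T -> (g j <= mu)%MM) (lcmg T <= mu)%MM.
Proof.
apply: (iffP mnm_lepP) => [h j jT|h i].
  apply/mnm_lepP => i; apply: leq_trans (h i); rewrite mnmE.
  exact: (@leq_bigmax_cond _ _ (fun j => g j i)).
by rewrite mnmE; apply/bigmax_leqP => j /h /mnm_lepP.
Qed.

Lemma lcmgS T U : T \subset U -> (lcmg T <= lcmg U)%MM.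
Proof.
by move=> /subsetP TU; apply/lcmgP => j /TU jU; apply: (lcmgP U _ (lepm_refl _)).
Qed.

Lemma lcmg0 : lcmg set0 = 0%MM.
Proof. by apply/mnmP => i; rewrite !mnmE big_set0. Qed.

Definition faces p : {set {set 'I_N}} := [set T : {set 'I_N} | #|T| == p].

(** Coordinates extended by 0 to subsets of the wrong size, which spares a transport
between subsets and their ranks in [faces p]. *)
Definition face_coef p (v : 'rV[S]_#|faces p|) T : S :=
  \sum_(i | enum_val i == T) v 0 i.

Definition taylor_diff p : 'M[S]_(#|faces p.+1|, #|faces p|) :=
  \matrix_(i < #|faces p.+1|, j < #|faces p|)
    \sum_(x | (x \notin enum_val j) && (x |: enum_val j == enum_val i))
       sgn k x (enum_val j) *: 'X_[lcmg (enum_val i) - lcmg (enum_val j)].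

(** The resolution of Taylor for the monomials [g]: the basis vector of T has the
multidegree of the lcm of T. The sign is taken relative to the smaller face,
which gives the same value as the larger one by [sgnU1id]. *)
Definition taylor : free_chain k n :=
  @FreeChain k n (fun p => #|faces p|)
    (fun p i => (mdeg (lcmg (enum_val i)))%:Z) taylor_diff (const_mx 1).

Lemma face_coef_enum p (v : 'rV[S]_#|faces p|) i : face_coef v (enum_val i) = v 0 i.
Proof.
rewrite /face_coef (eq_bigl (pred1 i)) ?big_pred1_eq // => j.
by rewrite /= (inj_eq enum_val_inj).
Qed.

Lemma face_coef_out p (v : 'rV[S]_#|faces p|) T : #|T| != p -> face_coef v T = 0.
Proof.
move=> Tp; rewrite /face_coef big_pred0 // => i; apply: contraNF Tp => /eqP <-.
by have := enum_valP i; rewrite inE.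
Qed.

Lemma face_coef_row p w T : #|T| = p ->
  face_coef (\row_(i < #|faces p|) w (enum_val i)) T = w T.
Proof.
move=> Tp; have TA : T \in faces p by rewrite inE Tp.
by rewrite -[T](enum_rankK_in TA TA) face_coef_enum mxE.
Qed.

Lemma face_coef_inj p (v w : 'rV[S]_#|faces p|) : face_coef v =1 face_coef w -> v = w.
Proof. by move=> e; apply/rowP => i; rewrite -!face_coef_enum e. Qed.

Lemma face_coef_diff p (v : 'rV[S]_#|faces p.+1|) U :
  face_coef (v *m taylor_diff p) U =
  \sum_(x | x \notin U)
    sgn k x U *: (face_coef v (x |: U) * 'X_[lcmg (x |: U) - lcmg U]).
Proof.
have [Up|Up] := eqVneq #|U| p; last first.
  rewrite face_coef_out // big1 // => x xU; rewrite face_coef_out ?mul0r ?scaler0 //.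
  by rewrite cardsU1 xU add1n eqSS.
have UA : U \in faces p by rewrite inE Up.
rewrite -[U](enum_rankK_in UA UA) face_coef_enum mxE; set j := enum_rank_in _ _.
under eq_bigr => i _ do rewrite mxE mulr_sumr.
rewrite (exchange_big_dep (fun x => x \notin enum_val j)) /=; last first.
  by move=> i x _ /andP[].
apply: eq_bigr => x xU.
rewrite mulr_suml scaler_sumr; apply: eq_big => [i|i].
  by rewrite xU eq_sym.
by move=> /andP[_ /eqP ->]; rewrite -scalerAr.
Qed.

Lemma mcoeffMX_le (f : S) b a :
  (f * 'X_[b])@_a = if (b <= a)%MM then f@_(a - b) else 0.
Proof.
case: ifP => [ba|/negbT ba]; first by rewrite -{1}(submK ba) addmC mcoeffMX.
apply: memN_msupp_eq0; apply: contraNN ba => /msuppM_le/allpairsP[[c d] /= [_ + ->]].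
by rewrite msuppX inE => /eqP ->; apply: lem_addl.
Qed.

(** The coefficient of x^(mu - lcm T) e_T. For fixed mu these form a simplicial
chain on the indices of the monomials that divide x^mu: the multigraded
strands of the Taylor complex are full simplices. *)
Definition mgraded_coef v mu T : k :=
  if (lcmg T <= mu)%MM then (v T)@_(mu - lcmg T) else 0.

Lemma mgraded_coefE v a T : mgraded_coef v (a + lcmg T) T = (v T)@_a.
Proof. by rewrite /mgraded_coef lem_addl addmK. Qed.

Lemma mgraded_coef_diff p (v : 'rV[S]_#|faces p.+1|) mu U :
  mgraded_coef (face_coef (v *m taylor_diff p)) mu U =
  face_sum (mgraded_coef (face_coef v) mu) U.
Proof.
rewrite /mgraded_coef face_coef_diff; case: ifP => Umu; last first.
  rewrite /face_sum big1 // => x xU; case: ifP => xUmu; last by rewrite mulr0.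
  by rewrite (lepm_trans (lcmgS (subsetUr [set x] U)) xUmu) in Umu.
rewrite raddf_sum /=; apply: eq_bigr => x xU.
rewrite mcoeffZ mcoeffMX_le; congr (_ * _).
have UxU := lcmgS (subsetUr [set x] U).
have -> : (lcmg (x |: U) - lcmg U <= mu - lcmg U)%MM = (lcmg (x |: U) <= mu)%MM.
  apply/mnm_lepP/mnm_lepP => h i; move: (h i) (mnm_lepP UxU i) (mnm_lepP Umu i);
    rewrite !mnmBE.
  - by move=> h1 h2 h3; move: h1; rewrite leq_subLR subnKC.
  - by move=> h1 _ _; apply: leq_sub2r.
case: ifP => // _; congr (_@_ _).
apply/mnmP => i; rewrite !mnmBE; have := mnm_lepP UxU i => h.
by rewrite subnBA // subnK // (mnm_lepP Umu).
Qed.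

Lemma mgraded_coef_inj p (v w : 'rV[S]_#|faces p|) :
  (forall mu T,
     mgraded_coef (face_coef v) mu T = mgraded_coef (face_coef w) mu T) -> v = w.
Proof.
by move=> e; apply: face_coef_inj => T; apply/mpolyP => a; rewrite -!mgraded_coefE e.
Qed.

Lemma taylor_mul p : taylor_diff p.+1 *m taylor_diff p = 0.
Proof.
apply/row_matrixP => i; rewrite row0 rowE mulmxA; apply: mgraded_coef_inj => mu U.
have -> : mgraded_coef (face_coef (0 : 'rV[S]_#|faces p|)) mu U = 0.
  by rewrite /mgraded_coef /face_coef big1 ?mcoeff0 ?if_same // => j _; rewrite mxE.
pose e : 'rV[S]_#|faces p.+2| := delta_mx 0 i.
rewrite mgraded_coef_diff -[RHS](face_sum_face_sum (mgraded_coef (face_coef e) mu) U).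
by apply: eq_bigr => x _; rewrite mgraded_coef_diff.
Qed.

(** Each strand mu that is a cycle is the boundary of its cone, with apex any
generator dividing x^mu; the strands of the cones are then assembled into a
vector of polynomials. *)
Lemma taylor_contract p (v : 'rV[S]_#|faces p|) :
  (forall mu U, face_sum (mgraded_coef (face_coef v) mu) U = 0) ->
  (forall mu T, mgraded_coef (face_coef v) mu T != 0 -> exists j, (g j <= mu)%MM) ->
  exists w : 'rV_#|faces p.+1|, v = w *m taylor_diff p.
Proof.
move=> cyc low; pose c := mgraded_coef (face_coef v).
pose b mu T := if [pick j | (g j <= mu)%MM] is Some z then cone z (c mu) T else 0.
have bP mu : face_sum (b mu) =1 c mu.
  rewrite /b => U; case: pickP => [z _|none].
    rewrite -[RHS](face_sum_cone z (c mu) U) [X in _ = _ + X](_ : _ = 0) ?addr0 //.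
    by rewrite /cone cyc mulr0 if_same.
  rewrite /face_sum big1 => [|x _]; last by rewrite mulr0.
  apply/esym/eqP/negPn/negP => /low[j].
  by rewrite none.
(* Coning only lowers the degree of coefficients, so M bounds all degrees in w. *)
pose M := \max_T msize (face_coef v T).
pose w T : S := \sum_(a : 'X_{1..n < M}) b (a + lcmg T)%MM T *: 'X_[a].
have b_nz mu T : b mu T != 0 ->
    exists z, [/\ z \in T, (g z <= mu)%MM & c mu (T :\ z) != 0].
  rewrite /b; case: pickP => [z gz|_]; last by rewrite eqxx.
  rewrite /cone; case: ifP => zT; last by rewrite eqxx.
  by rewrite mulf_eq0 negb_or => /andP[_ cz]; exists z.
have c_nz mu T : c mu T != 0 ->
    (lcmg T <= mu)%MM /\ (face_coef v T)@_(mu - lcmg T) != 0.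
  by rewrite /c /mgraded_coef; case: ifP => //; rewrite eqxx.
have wE a T : (w T)@_a = b (a + lcmg T)%MM T.
  have [aM|Ma] := ltnP (mdeg a) M; first
    by rewrite /w (mcoeff_mpoly (fun a => b (a + lcmg T)%MM T)).
  rewrite [in LHS]/w raddf_sum /= big1 => [|a' _].
    apply/esym/eqP/negPn/negP => /b_nz[z [zT _ /c_nz[_]]].
    rewrite -mcoeff_msupp => /msize_mdeg_lt; apply/negP; rewrite -leqNgt.
    apply: leq_trans (leq_bigmax (T :\ z)) (leq_trans Ma _).
    have /mnm_lepP lTz := lcmgS (subD1set T z).
    have -> : (a + lcmg T - lcmg (T :\ z) = a + (lcmg T - lcmg (T :\ z)))%MM.
      by apply/mnmP => i; rewrite !(mnmBE, mnmDE) addnBA.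
    by rewrite mdegD leq_addr.
  rewrite mcoeffZ mcoeffX; case: eqP => [aa'|]; last by rewrite mulr0.
  by have := bmdeg a'; rewrite aa' ltnNge Ma.
exists (\row_(i < #|faces p.+1|) w (enum_val i)); apply: mgraded_coef_inj => mu U.
rewrite mgraded_coef_diff -/(c mu U) -bP; apply: eq_bigr => x _; congr (_ * _).
move: (x |: U) => T; have [Tp|Tp] := eqVneq #|T| p.+1; last first.
  rewrite /mgraded_coef face_coef_out // mcoeff0 if_same.
  apply/eqP/negPn/negP => /b_nz[z [zT _ /c_nz[_]]].
  rewrite face_coef_out ?mcoeff0 ?eqxx //; apply: contra_neq Tp => <-.
  by rewrite (cardsD1 z T) zT.
rewrite /mgraded_coef face_coef_row //; case: ifP => Tmu; first by rewrite wE submK.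
apply/eqP/negPn/negP => /b_nz[z [zT gz /c_nz[Tz _]]]; move/negP: Tmu; case.
apply/lcmgP => j jT; have [-> //|jz] := eqVneq j z.
by apply: (lcmgP _ _ Tz); rewrite !inE jz.
Qed.

Definition above a : Prop := exists j, (g j <= a)%MM.

Lemma above_upward : upward above.
Proof. by move=> a b [j ga]; exists j; apply: lepm_trans ga (lem_addr _ _). Qed.

Lemma taylor_aug (v : 'rV[S]_#|faces 0|) :
  (v *m (const_mx 1 : 'cV_#|faces 0|)) 0 0 = face_coef v set0.
Proof.
rewrite mxE /face_coef; apply: eq_big => [i|i _]; last by rewrite mxE mulr1.
by rewrite /= -cards_eq0; have := enum_valP i; rewrite inE.
Qed.

(** In homological degree 0 the strand mu is nonzero only if x^mu occurs in an
element of J, and in positive degree only if x^mu is divisible by the lcm of a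
nonempty set; either way some generator divides x^mu and
[taylor_contract] applies. *)
Lemma taylor_resolution (J : S -> Prop) :
  (forall f, J f <-> mon_ideal above f) -> resolution J taylor.
Proof.
move=> JP; split=> /=.
- move=> i; rewrite mxE; have := enum_valP i; rewrite inE cards_eq0 => /eqP ->.
  by rewrite lcmg0 mdeg0 /= dhomog1.
- move=> p i j; rewrite mxE.
  apply/homog_intP => a; rewrite raddf_sum /=.
  have [->|da] := eqVneq a (lcmg (enum_val i) - lcmg (enum_val j))%MM.
    have [x xj|none] := pickP (fun x => (x \notin enum_val j) &&
                                 (x |: enum_val j == enum_val i)); last first.
      by rewrite big_pred0 // eqxx.
    move=> _; case/andP: xj => _ /eqP <-.
    have le := lcmgS (subsetUr [set x] (enum_val j)).
    by rewrite -[in RHS](submK le) mdegD PoszD addrK.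
  rewrite big1 ?eqxx // => x _; rewrite mcoeffZ mcoeffX eq_sym (negPf da).
  by rewrite mulr0.
- move=> f; exists (const_mx f); apply/JP; rewrite taylor_aug.
  have -> : const_mx f = \row_(i < #|faces 0|) (fun=> f) (enum_val i).
    by apply/rowP => i; rewrite !mxE.
  by rewrite face_coef_row ?cards0 // subrr; apply: mon_ideal0.
- move=> v; rewrite JP taylor_aug; split=> [Jv|[w ->] a].
    have c_nz mu T : mgraded_coef (face_coef v) mu T != 0 ->
        T = set0 /\ (face_coef v T)@_mu != 0.
      rewrite /mgraded_coef; case: ifP => _; last by rewrite eqxx.
      have [/eqP|T0] := eqVneq #|T| 0%N; last by rewrite face_coef_out // mcoeff0 eqxx.
      by rewrite cards_eq0 => /eqP ->; rewrite lcmg0 subm0.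
    apply: taylor_contract => [mu U|mu T /c_nz[-> /Jv] //].
    rewrite /face_sum big1 // => x xU; apply/eqP; rewrite mulf_eq0; apply/orP; right.
    apply/negPn/negP => /c_nz[/setP/(_ x)].
    by rewrite !inE eqxx.
  rewrite -mgraded_coefE mgraded_coef_diff lcmg0 addm0 /face_sum => nz.
  have [x [_ cx]] : exists x,
      x \notin set0 /\ mgraded_coef (face_coef w) a (x |: set0) != 0.
    have [/existsP[x /andP[x0 cx]]|/existsPn none] :=
      boolP [exists x, (x \notin set0) &&
        (mgraded_coef (face_coef w) a (x |: set0) != 0)].
      by exists x.
    case/eqP: nz; apply: big1 => x x0; have := none x.
    by rewrite x0 /= => /negPn/eqP ->; rewrite mulr0.
  exists x; move: cx; rewrite /mgraded_coef; case: ifP => [/lcmgP h _|_];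
    last by rewrite eqxx.
  by apply: h; rewrite !inE eqxx.
- move=> p v; split=> [v0|[w ->]]; last by rewrite -mulmxA taylor_mul mulmx0.
  apply: taylor_contract => [mu U|mu T].
    rewrite -mgraded_coef_diff v0 /mgraded_coef /face_coef big1 ?mcoeff0 ?if_same //.
    by move=> j _; rewrite mxE.
  rewrite /mgraded_coef; case: ifP => [/lcmgP Tmu|_]; last by rewrite eqxx.
  have [Tp|Tp] := eqVneq #|T| p.+1; last by rewrite face_coef_out // mcoeff0 eqxx.
  move=> _; have /card_gt0P[j jT] : (0 < #|T|)%N by rewrite Tp.
  by exists j; apply: Tmu.
Qed.

End Taylor.

(** * Koszul homology of monomial quotients *)

Section Koszul.
Variables (k : fieldType) (n : nat).
Notation S := {mpoly k[n]}.
Implicit Types (T U V : {set 'I_n}).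

Definition koszul : free_chain k n := taylor k (fun i : 'I_n => U_(i)%MM).

Lemma lcmgU T i : lcmg (fun i : 'I_n => U_(i)%MM) T i = (i \in T).
Proof.
rewrite mnmE; apply/eqP; rewrite eqn_leq; apply/andP; split.
  apply/bigmax_leqP => j jT; rewrite mnm1E; case: (j =P i) => // <-.
  by rewrite jT.
case: (boolP (i \in T)) => // iT.
by apply: leq_trans (leq_bigmax_cond _ iT); rewrite mnm1E eqxx.
Qed.

Lemma mdeg_lcmgU T : mdeg (lcmg (fun i : 'I_n => U_(i)%MM) T) = #|T|.
Proof.
rewrite mdegE -sum1_card [RHS]big_mkcond /=; apply: eq_bigr => i _.
by rewrite lcmgU; case: (i \in T).
Qed.

Lemma aboveU (a : 'X_{1..n}) : above (fun i : 'I_n => U_(i)%MM) a <-> mnonzero a.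
Proof.
split=> [[i ia]|a0].
  by apply/eqP => a0; move: ia; rewrite lep1mP a0 mnm0E eqxx.
have [i ai|none] := pickP (fun i => a i != 0%N); first by exists i; rewrite lep1mP.
case/eqP: a0; apply/mnmP => i; rewrite mnm0E; apply/eqP/negPn/negP => ai.
by have := none i; rewrite ai.
Qed.

Lemma mon_ideal_equiv (P P' : 'X_{1..n} -> Prop) (f : S) :
  (forall a, P a <-> P' a) -> (mon_ideal P f <-> mon_ideal P' f).
Proof. by move=> e; split=> h a /h /e. Qed.

Lemma koszul_resolution : resolution (@mon_ideal k n (@mnonzero n)) koszul.
Proof.
apply: taylor_resolution => f; apply: mon_ideal_equiv => a.
by rewrite aboveU.
Qed.

Definition kcoef p (w : 'cV[S]_(frank koszul p)) T : S := face_coef w^T T.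

Lemma kcoefP p c (x y : 'cV[S]_(frank koszul p)) T :
  kcoef (c%:MP *: x + y) T = c *: kcoef x T + kcoef y T.
Proof.
rewrite /kcoef /face_coef scaler_sumr -big_split; apply: eq_bigr => i _ /=.
by rewrite !mxE mul_mpolyC.
Qed.

Lemma kcoef_enum p (w : 'cV[S]_(frank koszul p)) i : kcoef w (enum_val i) = w i 0.
Proof. by rewrite /kcoef face_coef_enum mxE. Qed.

Lemma kcoef_ind (Q : S -> Prop) p (w : 'cV[S]_(frank koszul p)) :
  Q 0 -> ((forall i, Q (w i 0)) <-> (forall T, Q (kcoef w T))).
Proof.
move=> Q0; split=> h => [T|i]; last by rewrite -kcoef_enum.
have [Tp|Tp] := eqVneq #|T| p; last by rewrite /kcoef face_coef_out.
have TA : T \in faces n p by rewrite inE Tp.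
by rewrite -[T](enum_rankK_in TA TA) kcoef_enum.
Qed.

Lemma kcoef_diff p (w : 'cV[S]_(frank koszul p.+1)) U :
  kcoef ((fdiff koszul p)^T *m w) U =
  \sum_(x | x \notin U) sgn k x U *: (kcoef w (x |: U) * 'X_x).
Proof.
rewrite /kcoef trmx_mul trmxK face_coef_diff; apply: eq_bigr => x xU.
congr (_ *: (_ * 'X_[_])); apply/mnmP => i; rewrite mnmBE !lcmgU mnm1E !inE.
by rewrite eq_sym; case: (x =P i) => [<-|_] /=; rewrite ?(negPf xU) ?subnn.
Qed.

Definition kmonomial p T (a : 'X_{1..n}) : 'cV[S]_(frank koszul p) :=
  \col_(i < #|faces n p|) if enum_val i == T then 'X_[a] else 0.

Lemma kcoef_kmonomial p T U a : #|T| = p ->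
  kcoef (kmonomial p T a) U = if U == T then 'X_[a] else 0.
Proof.
move=> Tp; have [Up|Up] := eqVneq #|U| p; last first.
  by rewrite /kcoef face_coef_out //; case: eqP => // UT; rewrite UT Tp eqxx in Up.
have UA : U \in faces n p by rewrite inE Up.
by rewrite -[U](enum_rankK_in UA UA) kcoef_enum mxE.
Qed.

Variable q : int.
Notation khomog := (homog_mx (@codeg k n q koszul _) (fun=> 0)).

Lemma khomogP p (w : 'cV[S]_(frank koszul p)) :
  khomog w <-> forall T a, (kcoef w T)@_a != 0 -> (mdeg a)%:Z = q - p%:Z.
Proof.
rewrite -(kcoef_ind w (Q := fun f => forall a, f@_a != 0 -> (mdeg a)%:Z = q - p%:Z)).
  have codegE (i : 'I_(frank koszul p)) : @codeg k n q koszul p i = q - p%:Z.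
    rewrite /codeg /= mdeg_lcmgU; have := enum_valP i.
    by rewrite inE => /eqP ->.
  split=> h i => [a|j].
    by have /homog_intP/(_ a) := h i 0; rewrite subr0 codegE.
  by apply/homog_intP => a; rewrite (ord1 j) subr0 codegE => /h.
by move=> a; rewrite mcoeff0 eqxx.
Qed.

Lemma mon_ideal_mx_kcoef P p (w : 'cV[S]_(frank koszul p)) :
  mon_ideal_mx P w <-> forall T, mon_ideal P (kcoef w T).
Proof.
rewrite -(kcoef_ind w (mon_ideal0 P)).
by split=> h i => [|j]; rewrite ?(ord1 j); apply: h.
Qed.

Lemma khomog_diff p (w : 'cV[S]_(frank koszul p.+1)) :
  khomog w -> khomog ((fdiff koszul p)^T *m w).
Proof.
move=> /khomogP hw; apply/khomogP => T a; rewrite kcoef_diff raddf_sum /= => nz.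
have [x [xT]] : exists x, x \notin T /\ (kcoef w (x |: T) * 'X_x)@_a != 0.
  have [/existsP[x /andP[x0 cx]]|/existsPn none] :=
    boolP [exists x, (x \notin T) && ((kcoef w (x |: T) * 'X_x)@_a != 0)].
    by exists x.
  case/eqP: nz; apply: big1 => x xT; have := none x.
  by rewrite xT /= => /negPn/eqP cx; rewrite mcoeffZ cx mulr0.
rewrite mcoeffMX_le; case: ifP => [xa /hw|_]; last by rewrite eqxx.
move=> da; have := congr1 (@mdeg n) (submK xa); rewrite mdegD mdeg1 => <-.
by rewrite PoszD da -addn1 PoszD opprD addrA subrK.
Qed.

Lemma khomog_rows p (w : 'cV[S]_(frank koszul p)) :
  khomog w <-> homog_mx (fun=> q) (fdeg (f := koszul) (p := p)) w^T.
Proof.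
by split=> h i j; [rewrite mxE; have := h j i; rewrite subr0
                  |have := h j i; rewrite mxE subr0].
Qed.

Lemma koszul_exact p (w : 'cV[S]_(frank koszul p.+1)) :
  khomog w -> (fdiff koszul p)^T *m w = 0 ->
  exists2 y, khomog y & w = (fdiff koszul p.+1)^T *m y.
Proof.
move=> /khomog_rows hw w0.
have [|y hy wy] := exact_fdiff koszul_resolution hw.
  by apply: trmx_inj; rewrite trmx_mul trmxK w0 !linear0.
exists y^T; first by apply/khomog_rows; rewrite trmxK.
by apply: trmx_inj; rewrite wy trmx_mul !trmxK.
Qed.

Lemma koszul_exact0 (w : 'cV[S]_(frank koszul 0)) :
  khomog w -> q != 0 -> exists2 y, khomog y & w = (fdiff koszul 0)^T *m y.
Proof.
move=> hw q0; have /khomog_rows hwT := hw.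
have [|y hy wy] := exact_faug (fun f => iff_refl _) koszul_resolution hwT.
  move=> i j; rewrite (ord1 i) (ord1 j) taylor_aug => a nz.
  have /khomogP/(_ _ _ nz) := hw; rewrite subr0 => da.
  by apply: contraNN q0 => /eqP a0; rewrite -da a0 mdeg0.
exists y^T; first by apply/khomog_rows; rewrite trmxK.
by apply: trmx_inj; rewrite wy trmx_mul !trmxK.
Qed.

Section Homology.
Variable P : 'X_{1..n} -> Prop.
Hypothesis upP : upward P.
Notation cyc p := (@cycles_mod k n q P koszul p).
Notation bnd p := (@boundaries_mod k n q P koszul p).

Lemma khomog0 p : khomog (0 : 'cV[S]_(frank koszul p)).
Proof. exact: subspace0 (homog_mx_subspace k n _ _). Qed.

Lemma ideal_bound p (w : 'cV[S]_(frank koszul p)) : mon_ideal_mx P w -> bnd p w.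
Proof. by move=> Pw; exists 0; rewrite ?mulmx0 ?subr0 //; apply: khomog0. Qed.

(** The quotient S/J vanishes in the degree q - p of the coefficients. *)
Lemma koszul_top p :
  (forall a, (mdeg a)%:Z = q - p%:Z -> P a) -> quotient_dim (cyc p) (bnd p) 0.
Proof.
move=> Pe; apply: quotient_dim0; first exact: cycles_mod_subspace.
move=> w /cycles_mod_homog_mx/khomogP hw; apply: ideal_bound.
apply/mon_ideal_mx_kcoef => T a.
by move/hw/Pe.
Qed.

(** If J has nothing in degree q - p + 1, a cycle modulo J has boundary 0, and the
Koszul complex is exact; in homological degree 0, forms of nonzero degree are
combinations of the variables. *)
Lemma koszul_acyclic p :
  ~ (p = 0%N /\ q = 0) ->
  p = 0%N \/ (forall a, (mdeg a)%:Z = q - p%:Z + 1 -> ~ P a) ->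
  quotient_dim (cyc p) (bnd p) 0.
Proof.
move=> pq Pe; apply: quotient_dim0; first exact: cycles_mod_subspace.
move=> w cw; have hw := cycles_mod_homog_mx cw.
suff [y hy ->] : exists2 y, khomog y & w = (fdiff koszul p)^T *m y.
  by exists y => //; rewrite subrr; apply: mon_ideal_mx0.
case: p pq Pe w cw hw => [|p] pq Pe w cw hw.
  by apply: koszul_exact0 => //; apply/eqP => q0; apply: pq.
case: Pe => // Pe; case: cw => _ /mon_ideal_mx_kcoef wP.
apply: koszul_exact => //; have /khomogP hDw := khomog_diff hw.
apply/matrixP => i j; rewrite (ord1 j) -kcoef_enum mxE; apply/mpolyP => a.
rewrite mcoeff0; apply/eqP/negPn/negP => nz; apply: (Pe a); last exact: wP nz.
by rewrite (hDw _ _ nz) -addn1 PoszD opprD addrA subrK.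
Qed.

End Homology.

Lemma koszul_00 (P : 'X_{1..n} -> Prop) : upward P -> ~ P 0%MM -> q = 0 ->
  quotient_dim (@cycles_mod k n q P koszul 0) (@boundaries_mod k n q P koszul 0) 1.
Proof.
move=> upP P0 q0.
suff: quotient_dim (@cycles_mod k n q P koszul 0) (@boundaries_mod k n q P koszul 0)
           #|[set (set0 : {set 'I_n})]| by rewrite cards1.
apply: (@quotient_dim_coords _ _ _ _ _ _ _ (fun w T => (kcoef w T)@_0%MM)).
- exact: (cycles_mod_subspace q koszul upP 0).
- by move=> c x y T; rewrite kcoefP mcoeffD mcoeffZ.
- move=> T /set1P ->; exists (kmonomial 0 set0 0%MM).
    apply/khomogP => U a; rewrite kcoef_kmonomial ?cards0 //; case: ifP => _.
      by rewrite mcoeffX; case: (0%MM =P a) => [<-|_]; rewrite ?eqxx // mdeg0 q0.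
    by rewrite mcoeff0 eqxx.
  by move=> U /set1P ->; rewrite kcoef_kmonomial ?cards0 // !eqxx mcoeffX eqxx.
- move=> w hw; split.
    move=> [y hy /mon_ideal_mx_kcoef wy] T _; apply/eqP/negPn/negP => nz.
    case: P0; apply: (wy T).
    rewrite -[w - _]addrC -[- _]scaleN1r -mpolyC1 -mpolyCN kcoefP mcoeffD mcoeffZ.
    rewrite kcoef_diff raddf_sum big1 ?mulr0 ?add0r // => x _ /=.
    by rewrite mcoeffZ mcoeffMX_le lep1mP mnm0E eqxx mulr0.
  move=> w0; apply: ideal_bound; apply/mon_ideal_mx_kcoef => T a nz.
  have /khomogP/(_ _ _ nz) := hw; rewrite q0 subr0 => -[/eqP].
  rewrite mdeg_eq0 => /eqP a0; move: nz; rewrite a0.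
  have [/eqP|T0] := eqVneq #|T| 0%N.
    by rewrite cards_eq0 => /eqP ->; rewrite w0 ?inE ?eqxx.
  by rewrite /kcoef face_coef_out // mcoeff0 eqxx.
Qed.

Lemma coord_sum p (I : finType) (z : I -> 'cV[S]_(frank koszul p)) (c : I -> k) T a :
  (kcoef (\sum_i (c i)%:MP *: z i) T)@_a = \sum_i c i * (kcoef (z i) T)@_a.
Proof.
have k0 : (kcoef (0 : 'cV[S]_(frank koszul p)) T)@_a = 0.
  by rewrite /kcoef /face_coef big1 ?mcoeff0 // => i _; rewrite !mxE.
elim: (index_enum I) => [|i s IHs]; first by rewrite !big_nil.
by rewrite !big_cons kcoefP mcoeffD mcoeffZ IHs.
Qed.

Section Socle.
Variable m : 'X_{1..n}.
Notation d := (mdeg m).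

(** A term x_j f e_U of the boundary has j outside U, hence outside supp(m), and m
is not a multiple of x_j. *)
Lemma coord_supp p (y : 'cV[S]_(frank koszul p.+1)) U :
  msupport m \subset U -> (kcoef ((fdiff koszul p)^T *m y) U)@_m = 0.
Proof.
move=> /subsetP mU; rewrite kcoef_diff raddf_sum big1 //= => x xU.
rewrite mcoeffZ mcoeffMX_le; case: ifP => [xm|_]; last by rewrite mulr0.
by have := mU x; rewrite inE xm (negPf xU) => /(_ isT).
Qed.

(** The chain (m/x_j) e_{U + j} with j in supp(m) outside U: its boundary is m e_U
up to sign, plus multiples of monomials (m/x_j) x_i other than m. *)
Lemma coord_lift p U : #|U| = p -> q = (p + d)%:Z -> ~~ (msupport m \subset U) ->
  exists2 y : 'cV[S]_(frank koszul p.+1), khomog y &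
    forall V, (kcoef ((fdiff koszul p)^T *m y) V)@_m = (V == U)%:R.
Proof.
move=> Up qE /subsetPn[j]; rewrite inE => jm jU.
have jUp : #|j |: U| = p.+1 by rewrite cardsU1 jU Up.
exists ((sgn k j U)%:MP *: kmonomial p.+1 (j |: U) (m - U_(j))%MM).
  apply/khomogP => T a; rewrite -[_ *: _]addr0 kcoefP.
  have -> : kcoef (0 : 'cV[S]_(frank koszul p.+1)) T = 0.
    by rewrite /kcoef /face_coef big1 // => i _; rewrite !mxE.
  rewrite addr0 mcoeffZ kcoef_kmonomial //; case: ifP => _;
    last by rewrite mcoeff0 mulr0 eqxx.
  rewrite mcoeffX; case: (_ =P a) => [<-|_]; last by rewrite mulr0 eqxx.
  move=> _; rewrite qE -(submK jm) mdegD mdeg1 addmK addn1 addnS -addSn.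
  by rewrite PoszD addrC addKr.
move=> V; rewrite kcoef_diff raddf_sum /=.
have term x : x \notin V ->
    (sgn k x V *: (kcoef ((sgn k j U)%:MP *: kmonomial p.+1 (j |: U) (m - U_(j))%MM)
      (x |: V) * 'X_x))@_m = ((x == j) && (V == U))%:R.
  move=> xV; rewrite -[_%:MP *: _]addr0 kcoefP.
  have -> : kcoef (0 : 'cV[S]_(frank koszul p.+1)) (x |: V) = 0.
    by rewrite /kcoef /face_coef big1 // => i _; rewrite !mxE.
  rewrite addr0 kcoef_kmonomial // mcoeffZ mcoeffMX_le.
  case: (x =P j) xV => [->|/eqP xj] xV /=.
    rewrite jm mcoeffZ; case: (V =P U) => [->|VU].
      by rewrite eqxx mcoeffX eqxx mulr1 sgn_sqr.
    case: eqP => [jVU|_]; last by rewrite mcoeff0 !mulr0.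
    by case: VU; rewrite -(setU1K xV) jVU setU1K.
  case: ifP => [xm|_]; last by rewrite mulr0.
  rewrite mcoeffZ; case: eqP => _; last by rewrite mcoeff0 !mulr0.
  rewrite mcoeffX; case: eqP => [e|_]; last by rewrite !mulr0.
  have := congr1 (fun a => (a : 'X_{1..n}) j) e.
  rewrite !mnmBE !mnm1E eqxx (negPf xj) subn0.
  by move: jm; rewrite lep1mP; case: (m j) => // l _ /eqP; rewrite subn1 /= ltn_eqF.
rewrite (eq_bigr _ term); have [VU|VU] := eqVneq V U; last first.
  by rewrite big1 // => x _; rewrite andbF.
rewrite (bigD1 j) ?VU //= eqxx big1 ?addr0 // => x /andP[_ /negPf ->] //.
Qed.

(** The monomials of (x_1, ..., x_n)^d and, below, those of the ideal that misses m. *)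
Definition full_mon (a : 'X_{1..n}) : Prop := (d <= mdeg a)%N.
Definition punctured_mon (a : 'X_{1..n}) : Prop := (d <= mdeg a)%N /\ a <> m.

Lemma full_mon_upward : upward full_mon.
Proof.
by move=> a b; rewrite /full_mon mdegD => h; apply: leq_trans h (leq_addr _ _).
Qed.

Lemma punctured_mon_upward : upward punctured_mon.
Proof.
move=> a b [da am]; split; first exact: full_mon_upward.
move=> abm; have := congr1 (@mdeg n) abm; rewrite mdegD => e.
have b0 : mdeg b = 0%N by apply/eqP; rewrite -leqn0 -(leq_add2l (mdeg a)) e addn0.
by case: am; rewrite -abm; move/eqP: b0; rewrite mdeg_eq0 => /eqP ->; rewrite addm0.
Qed.

(** In coefficient degree d every chain is a cycle. The coefficients of m at the
subsets over supp(m) vanish on boundaries by [coord_supp]; when they vanish,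
the lifts of [coord_lift] correct the remaining coefficients of m by a
boundary. *)
Lemma koszul_socle p : q = (p + d)%:Z ->
  quotient_dim (@cycles_mod k n q punctured_mon koszul p)
       (@boundaries_mod k n q punctured_mon koszul p)
       #|[set U in faces n p | msupport m \subset U]|.
Proof.
move=> qE; have e_eq : q - p%:Z = d%:Z by rewrite qE PoszD addrC addKr.
have cycE (w : 'cV_(frank koszul p)) : khomog w <-> cycles_mod q punctured_mon w.
  split=> [hw|]; last exact: cycles_mod_homog_mx.
  case: p qE e_eq w hw => [|p] qE e_eq w hw //; split=> //.
  apply/mon_ideal_mx_kcoef => T a; have /khomogP hDw := khomog_diff hw.
  move/hDw; rewrite qE addSn -addnS PoszD addrC addKr => -[da].
  rewrite /punctured_mon da leqnSn; split=> // am.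
  by move: da; rewrite am => /eqP; rewrite ltn_eqF.
apply: (@quotient_dim_coords _ _ _ _ _ _ _ (fun w T => (kcoef w T)@_m)).
- exact: (cycles_mod_subspace q koszul punctured_mon_upward p).
- by move=> c x y T; rewrite kcoefP mcoeffD mcoeffZ.
- move=> T; rewrite !inE => /andP[/eqP Tp mT]; exists (kmonomial p T m).
    apply/cycE/khomogP => U a; rewrite kcoef_kmonomial //; case: ifP => _.
      by rewrite mcoeffX; case: (m =P a) => [<-|_]; rewrite ?eqxx.
    by rewrite mcoeff0 eqxx.
  move=> U _; rewrite kcoef_kmonomial //.
  by case: eqP; rewrite ?mcoeffX ?mcoeff0 ?eqxx.
- move=> w /cycE hw; split.
    move=> [y hy /mon_ideal_mx_kcoef wy] T; rewrite !inE => /andP[_ mT].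
    apply/eqP/negPn/negP => nz; case: (wy T m) => //.
    rewrite -[w - _]addrC -[- _]scaleN1r -mpolyC1 -mpolyCN kcoefP mcoeffD mcoeffZ.
    by rewrite coord_supp // mulr0 add0r.
  move=> w0.
  have lift U : exists y : 'cV[S]_(frank koszul p.+1), khomog y /\
      (#|U| = p -> ~~ (msupport m \subset U) ->
       forall V, (kcoef ((fdiff koszul p)^T *m y) V)@_m = (V == U)%:R).
    have [/andP[/eqP Up mU]|nU] := boolP ((#|U| == p) && ~~ (msupport m \subset U)).
      by have [y hy yE] := coord_lift Up qE mU; exists y.
    exists 0; split; first exact: khomog0.
    by move=> Up mU; rewrite Up eqxx mU in nU.
  have [y yP] := fin_all_exists lift.
  (* Only the coefficients of m at the subsets not over supp(m) need a correction. *)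
  pose c U := if (#|U| == p) && ~~ (msupport m \subset U) then (kcoef w U)@_m else 0.
  have hyc : khomog (\sum_U (c U)%:MP *: y U).
    apply: (@subspace_sum k n _ (homog_mx (@codeg k n q koszul p.+1) (fun=> 0)))
      => [|U _]; first exact: homog_mx_subspace.
    by apply: subspaceZ (homog_mx_subspace k n _ _) _; case: (yP U).
  exists (\sum_U (c U)%:MP *: y U) => //.
  have hY : khomog (w - (fdiff koszul p)^T *m \sum_U (c U)%:MP *: y U).
    exact: subspaceB (homog_mx_subspace k n _ _) hw (khomog_diff hyc).
  apply/mon_ideal_mx_kcoef => V a nz.
  have /khomogP/(_ _ _ nz) := hY; rewrite e_eq => -[da].
  split; first by rewrite da.
  move=> am; move: nz; rewrite am => /eqP; apply.
  rewrite -[w - _]addrC -[- _]scaleN1r -mpolyC1 -mpolyCN kcoefP mcoeffD mcoeffZ.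
  rewrite mulmx_sumr.
  rewrite (eq_bigr (fun U => (c U)%:MP *: ((fdiff koszul p)^T *m y U))); last first.
    by move=> U _; rewrite -scalemxAr.
  rewrite coord_sum (eq_bigr (fun U => c U * (V == U)%:R)); last first.
    move=> U _; rewrite /c; case: ifP => [/andP[/eqP Up mU]|]; last by rewrite !mul0r.
    by case: (yP U) => _ ->.
  rewrite (bigD1 V) //= eqxx mulr1 big1 ?addr0 => [|U VU]; last first.
    by rewrite eq_sym (negPf VU) mulr0.
  rewrite mulN1r /c; case: ifP => [_|/negbT]; first by rewrite addNr.
  rewrite oppr0 add0r negb_and negbK => /orP[Vp|mV].
    by rewrite /kcoef face_coef_out // mcoeff0.
  have [Vp|Vp] := eqVneq #|V| p; last by rewrite /kcoef face_coef_out // mcoeff0.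
  by apply: w0; rewrite !inE Vp eqxx.
Qed.

(** Comparison of cycles for the two ideals in coefficient degree d - 1, where
boundaries are the same: the quotient of the cycles has for coordinates the
coefficients of m in the boundary, which [coord_supp] kills at the subsets over
supp(m) and [coord_lift] makes arbitrary at the others. *)
Lemma koszul_linear p r s : q = (p + d)%:Z -> 
  quotient_dim (@cycles_mod k n q full_mon koszul p.+1)
    (@boundaries_mod k n q full_mon koszul p.+1) r ->
  quotient_dim (@cycles_mod k n q punctured_mon koszul p.+1)
    (@boundaries_mod k n q punctured_mon koszul p.+1) s ->
  r = (#|[set U in faces n p | ~~ (msupport m \subset U)]| + s)%N.
Proof.
move=> qE qr qs.
have e_eq : q - p%:Z = d%:Z by rewrite qE PoszD addrC addKr.
have e1 : q - p.+1%:Z = d%:Z - 1 by rewrite -addn1 PoszD opprD addrA e_eq.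
(* A form of degree d - 1 in either ideal is 0, so both have the same boundaries. *)
have low (P : 'X_{1..n} -> Prop) (w : 'cV_(frank koszul p.+1)) :
    (forall a, P a -> (d <= mdeg a)%N) -> khomog w ->
    boundaries_mod q P w <->
    exists2 y, khomog y & w = (fdiff koszul p.+1)^T *m y.
  move=> Pd hw; split=> [[y hy /mon_ideal_mx_kcoef wy]|[y hy ->]]; exists y => //;
    last first.
    by rewrite subrr; apply: mon_ideal_mx0.
  have hwy : khomog (w - (fdiff koszul p.+1)^T *m y).
    exact: subspaceB (homog_mx_subspace k n _ _) hw (khomog_diff hy).
  apply/eqP; rewrite -subr_eq0; apply/eqP/matrixP => i j.
  rewrite (ord1 j) -kcoef_enum [RHS]mxE; apply/mpolyP => a; rewrite mcoeff0.
  apply/eqP/negPn/negP => nz; have /Pd := wy _ _ nz.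
  have /khomogP/(_ _ _ nz) := hwy; rewrite e1 => /eqP.
  by rewrite eq_sym subr_eq -PoszD addn1 eqz_nat => /eqP ->; rewrite ltnn.
have full_low a : full_mon a -> (d <= mdeg a)%N by [].
have punctured_low a : punctured_mon a -> (d <= mdeg a)%N by case.
pose C (w : 'cV_(frank koszul p.+1)) :=
  khomog w /\ exists2 y, khomog y & w = (fdiff koszul p.+1)^T *m y.
have degD (w : 'cV_(frank koszul p.+1)) T a :
    khomog w -> (kcoef ((fdiff koszul p)^T *m w) T)@_a != 0 -> mdeg a = d.
  by move=> /khomog_diff/khomogP h /h; rewrite e_eq => -[].
have qA : quotient_dim (@cycles_mod k n q full_mon koszul p.+1)
    (@cycles_mod k n q punctured_mon koszul p.+1)
    #|[set U in faces n p | ~~ (msupport m \subset U)]|.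
  apply: (@quotient_dim_coords _ _ _ _ _ _ _
    (fun w U => (kcoef ((fdiff koszul p)^T *m w) U)@_m)).
  - exact: (cycles_mod_subspace q koszul full_mon_upward p.+1).
  - by move=> c x y T; rewrite mulmxDr -scalemxAr kcoefP mcoeffD mcoeffZ.
  - move=> U; rewrite !inE => /andP[/eqP Up mU].
    have [y hy yE] := coord_lift Up qE mU; exists y; last by move=> V _.
    split=> //; apply/mon_ideal_mx_kcoef => T a /(degD _ _ _ hy) da.
    by rewrite /full_mon da.
  - move=> w [hw _]; split.
      move=> [_ /mon_ideal_mx_kcoef Dw] U _; apply/eqP/negPn/negP => /Dw[_].
      by apply.
    move=> w0; split=> //; apply/mon_ideal_mx_kcoef => T a nz.
    have da := degD _ _ _ hw nz; split; first by rewrite da.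
    move=> am; move: nz; rewrite am => /eqP; apply.
    have [mT|mT] := boolP (msupport m \subset T); first exact: coord_supp.
    have [Tp|Tp] := eqVneq #|T| p; last by rewrite /kcoef face_coef_out // mcoeff0.
    by apply: w0; rewrite !inE Tp eqxx.
have bz (w : 'cV_(frank koszul p.+1)) : C w -> cycles_mod q punctured_mon w.
  move=> [hw [y hy wy]]; split=> //.
  rewrite wy mulmxA -trmx_mul (fdiff_mul koszul_resolution) trmx0 mul0mx.
  exact: mon_ideal_mx0.
apply: (@quotient_dim_uniq _ _ _ (@cycles_mod k n q full_mon koszul p.+1) C).
  apply: quotient_dim_ext qr => // w /cycles_mod_homog_mx hw.
  rewrite (low _ _ full_low hw).
  by split=> [|[]].
apply: (quotient_dim_add bz _ qA).
  move=> w [hw Dw]; split=> // i j a /Dw[]; exact.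
apply: quotient_dim_ext qs => // w /cycles_mod_homog_mx hw.
rewrite (low _ _ punctured_low hw).
by split=> [|[]].
Qed.

End Socle.
End Koszul.

(** * The two ideals and their Betti numbers *)

Section Ideals.
Variables (k : fieldType) (n : nat).
Notation S := {mpoly k[n]}.
Implicit Types (a b : 'X_{1..n}) (f h : S).

Lemma ideal_gen_sum (G : S -> Prop) (I : eqType) (s : seq I) (c h : I -> S) :
  (forall i, i \in s -> G (h i)) -> ideal_gen G (\sum_(i <- s) c i * h i).
Proof.
move=> Gh; exists [seq (c i, h i) | i <- s]; last by rewrite big_map.
by move=> _ /mapP[i /Gh Ghi ->].
Qed.

Lemma ideal_gen_sub (G : S -> Prop) (P : 'X_{1..n} -> Prop) f :
  upward P -> (forall h, G h -> mon_ideal P h) -> ideal_gen G f -> mon_ideal P f.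
Proof.
move=> upP GP [r rG ->]; rewrite big_seq; apply: big_ind.
- exact: mon_ideal0.
- exact: mon_idealD.
- by move=> i /rG/GP; rewrite mulrC; apply: mon_idealM.
Qed.

Lemma mon_ideal_gen (G : S -> Prop) (P : 'X_{1..n} -> Prop) f :
  (forall a, P a -> exists2 b, (b <= a)%MM & G 'X_[b]) ->
  mon_ideal P f -> ideal_gen G f.
Proof.
move=> PG Pf; have lift a : exists b, P a -> (b <= a)%MM /\ G 'X_[b].
  have [Pa|nPa] := classic (P a); last by exists 0%MM.
  by have [b ba Gb] := PG a Pa; exists b.
pose b a := proj1_sig (constructive_indefinite_description _ (lift a)).
have bP a : P a -> (b a <= a)%MM /\ G 'X_[b a] := proj2_sig
  (constructive_indefinite_description _ (lift a)).
have supP a : a \in msupp f -> P a by rewrite mcoeff_msupp; apply: Pf.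
have -> : f = \sum_(a <- msupp f) (f@_a *: 'X_[a - b a]) * 'X_[b a].
  rewrite [LHS]mpolyE; apply: eq_big_seq => a /supP/bP[ba _].
  by rewrite -scalerAl -mpolyXD submK.
by apply: ideal_gen_sum => a /supP/bP[].
Qed.

Lemma mon_ideal_prod d (h : 'I_d -> S) :
  (forall i, mon_ideal (@mnonzero n) (h i)) ->
  mon_ideal (fun a => d <= mdeg a)%N (\prod_(i < d) h i).
Proof.
elim: d h => [|d IHd] h h0; first by move=> a.
rewrite big_ord_recl => a; rewrite -mcoeff_msupp.
move=> /msuppM_le/allpairsP[[b c] /= []]; rewrite !mcoeff_msupp => hb hc ->.
rewrite mdegD -add1n leq_add //.
  by rewrite lt0n mdeg_eq0; apply: h0 hb.
by apply: (IHd (fun i => h (lift ord0 i))) hc => i; apply: h0.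
Qed.

Lemma mdeg_le_vars d a : (d <= mdeg a)%N ->
  exists t : 'I_d -> 'I_n, (\sum_(i < d) U_(t i) <= a)%MM.
Proof.
elim: d a => [|d IHd] a da.
  exists (fun i : 'I_0 => match notF (ltn_ord i) with end).
  by rewrite big_ord0; apply/mnm_lepP => i; rewrite mnm0E.
have [i ai] : exists i, (U_(i) <= a)%MM.
  apply/(aboveU a); apply/eqP => a0.
  by rewrite a0 mdeg0 in da.
have da' : (d <= mdeg (a - U_(i))%MM)%N.
  by rewrite -(submK ai) mdegD mdeg1 addn1 in da.
have [t ta] := IHd _ da'.
exists (fun l => if unlift ord0 l is Some l' then t l' else i).
rewrite big_ord_recl unlift_none.
under eq_bigr => l _ do rewrite liftK.
rewrite -(submK ai) addmC; apply/mnm_lepP => l; rewrite !mnmDE leq_add2r.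
exact: (mnm_lepP ta).
Qed.

Lemma mdeg_le_divisor d a : (d <= mdeg a)%N -> exists2 b, (b <= a)%MM & mdeg b = d.
Proof.
move=> /mdeg_le_vars[t ta]; exists (\sum_(i < d) U_(t i))%MM => //.
rewrite mdeg_sum /= (eq_bigr (fun=> 1%N)) ?sum_nat_const ?card_ord ?muln1 // => i _.
exact: mdeg1.
Qed.

Lemma ideal_powE d f :
  ideal_pow (@var_ideal k n) d f <-> mon_ideal (fun a => d <= mdeg a)%N f.
Proof.
have up : upward (fun a : 'X_{1..n} => (d <= mdeg a)%N : Prop).
  by move=> a b h; rewrite mdegD; apply: leq_trans h (leq_addr _ _).
have var (h : S) : var_ideal h -> mon_ideal (@mnonzero n) h.
  apply: ideal_gen_sub (@mnonzero_upward n) _ => _ [i ->] a.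
  rewrite mcoeffX; case: (_ =P a) => [<-|_]; rewrite ?eqxx //.
  by rewrite /mnonzero mnm1_eq0.
split.
  by apply: ideal_gen_sub up _ => _ [g gJ ->]; apply: mon_ideal_prod => i; apply: var.
apply: mon_ideal_gen => a /mdeg_le_vars[t ta]; exists (\sum_(i < d) U_(t i))%MM => //.
exists (fun i => 'X_(t i)); last by rewrite mprodXE.
move=> i; exists [:: (1, 'X_(t i))]; last by rewrite big_seq1 mul1r.
by move=> cg; rewrite inE => /eqP ->; exists (t i).
Qed.

Section Except.
Variables (m : 'X_{1..n}).
Hypothesis m_supp : (1 < #|msupport m|)%N.

(** This is where supp(m) must have at least two elements: a monomial x_i m also has
the divisor x_i m / x_j of degree d, with x_j in supp(m) and j <> i. *)
Lemma divisor_except a : punctured_mon m a <->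
  exists b, [/\ mdeg b = mdeg m, b != m & (b <= a)%MM].
Proof.
split=> [[ma am]|[b [db bm ba]]]; last first.
  have le : (mdeg m <= mdeg a)%N by rewrite -db -(submK ba) mdegD leq_addl.
  split=> // am; case/eqP: bm.
  have := submK ba => e; have := congr1 (@mdeg n) e; rewrite mdegD am db => z.
  have /eqP : mdeg (a - b) = 0%N.
    by move: z; rewrite am => /eqP; rewrite -[X in _ == X]add0n eqn_add2r => /eqP.
  by rewrite mdeg_eq0 => /eqP ab; rewrite -am -e ab add0m.
have [e|ne] := eqVneq (mdeg a) (mdeg m).
  by exists a; rewrite lepm_refl; split=> //; apply/eqP.
have ltma : (mdeg m < mdeg a)%N by rewrite ltn_neqAle eq_sym ne.
(* A divisor c of degree d + 1: it suffices to find a divisor of c other than m. *)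
have [c ca dc] := mdeg_le_divisor ltma.
have [cm|ncm] := boolP (m <= c)%MM; last first.
  have [b bc db] : exists2 b, (b <= c)%MM & mdeg b = mdeg m.
    by apply: mdeg_le_divisor; rewrite dc.
  exists b; split=> //; last exact: lepm_trans bc ca.
  by apply: contraNneq ncm => <-.
have /eqP : mdeg (c - m) = 1%N.
  have := congr1 (@mdeg n) (submK cm); rewrite mdegD dc -add1n.
  by move/eqP; rewrite eqn_add2r => /eqP.
rewrite mdeg_eq1 => /existsP[i /eqP ci].
have cE : c = (U_(i) + m)%MM by rewrite -ci submK.
have [j jm ji] : exists2 j, j \in msupport m & j != i.
  have : (0 < #|msupport m :\ i|)%N.
    by have := m_supp; rewrite (cardsD1 i); case: (i \in _) => //=; apply: ltnW.
  by case/card_gt0P => j; rewrite !inE => /andP[]; exists j; rewrite ?inE.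
rewrite inE in jm; exists (U_(i) + (m - U_(j)))%MM; split.
- by rewrite mdegD mdeg1 -[in RHS](submK jm) mdegD mdeg1 addnC.
- apply/eqP => /(congr1 (fun a : 'X_{1..n} => a j)); rewrite mnmDE mnmBE !mnm1E eqxx.
  by rewrite eq_sym (negPf ji); move: jm; rewrite lep1mP; case: (m j) => // l _; lia.
- apply: lepm_trans ca; rewrite cE; apply/mnm_lepP => l.
  by rewrite !mnmDE leq_add2l mnmBE leq_subr.
Qed.

Lemma monomials_exceptE f :
  monomials_except_ideal (mdeg m) m f <-> mon_ideal (punctured_mon m) f.
Proof.
split.
  apply: ideal_gen_sub (@punctured_mon_upward _ m) _ => _ [b [db bm ->]] a.
  rewrite mcoeffX; case: (b =P a) => [<- _|]; last by rewrite eqxx.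
  by apply/divisor_except; exists b; rewrite lepm_refl.
apply: mon_ideal_gen => a /divisor_except[b [db bm ba]].
by exists b => //; exists b.
Qed.

End Except.

(** Monomials of bounded degree form a finite type, which provides an indexing. *)
Lemma finite_generators (Q : pred 'X_{1..n}) e : (forall a, Q a -> (mdeg a < e)%N) ->
  exists N (g : 'I_N -> 'X_{1..n}),
    forall a, above g a <-> exists2 b, Q b & (b <= a)%MM.
Proof.
move=> Qe; pose A := [set b : 'X_{1..n < e} | Q (bmnm b)].
exists #|A|, (fun i => bmnm (enum_val i)) => a; split=> [[i ia]|[b Qb ba]].
  by exists (bmnm (enum_val i)) => //; have := enum_valP i; rewrite inE.
have bA : BMultinom (Qe b Qb) \in A by rewrite inE.
by exists (enum_rank_in bA (BMultinom (Qe b Qb))); rewrite enum_rankK_in.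
Qed.

(** [betti] selects the value given by some resolution; the Taylor resolution shows
that there is one, and balancing computes its value by Koszul homology. *)
Lemma quotient_dim_betti (J : S -> Prop) (P : 'X_{1..n} -> Prop) N
    (g : 'I_N -> 'X_{1..n}) p q :
  (forall f, J f <-> mon_ideal P f) -> (forall a, P a <-> above g a) ->
  quotient_dim (@cycles_mod k n q P (koszul k n) p)
    (@boundaries_mod k n q P (koszul k n) p)
       (betti J p q).
Proof.
move=> JP Pg; have upP : upward P.
  by move=> a b /Pg/above_upward h; apply/Pg.
rewrite /betti; set b := epsilon _ _.
have [F resF ->] : exists2 F, resolution J F & b = thomology_dim F p q.
  apply: (@epsilon_spec nat (inhabits 0%N)
    (fun x => exists2 F, resolution J F & x = thomology_dim F p q)).
  exists (thomology_dim (taylor k g) p q), (taylor k g) => //.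
  apply: taylor_resolution => f; rewrite JP; exact: mon_ideal_equiv.
apply: (quotient_dim_balance upP JP resF (@mnonzero_upward n) (fun f => iff_refl _)
  (koszul_resolution k n)).
exact: quotient_dim_tor resF p.
Qed.

End Ideals.

Lemma subn_subn_subn a b c :
  (a <= b)%N -> (b <= c)%N -> (c - a - (c - b) = b - a)%N.
Proof. lia. Qed.

Section Values.
Variables (k : fieldType) (n : nat) (m : 'X_{1..n}).
Notation d := (mdeg m).
Notation s := #|msupport m|.
Hypothesis s_gt1 : (1 < s)%N.
Let I := ideal_pow (@var_ideal k n) d.
Let Ihat := @monomials_except_ideal k n d m.

Lemma full_betti p q :
  quotient_dim (@cycles_mod k n q (full_mon m) (koszul k n) p)
       (@boundaries_mod k n q (full_mon m) (koszul k n) p) (betti I p q).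
Proof.
have [|N [g gP]] := @finite_generators n (fun a => mdeg a == d) d.+1.
  by move=> a /eqP ->.
apply: (@quotient_dim_betti _ _ _ _ N g); first exact: ideal_powE.
move=> a; rewrite gP; split=> [/mdeg_le_divisor[b ba db]|[b /eqP db ba]].
  by exists b => //; apply/eqP.
by rewrite /full_mon -db -(submK ba) mdegD leq_addl.
Qed.

Lemma punctured_betti p q :
  quotient_dim (@cycles_mod k n q (punctured_mon m) (koszul k n) p)
       (@boundaries_mod k n q (punctured_mon m) (koszul k n) p) (betti Ihat p q).
Proof.
have [|N [g gP]] := @finite_generators n (fun a => (mdeg a == d) && (a != m)) d.+1.
  by move=> a /andP[/eqP ->].
apply: (@quotient_dim_betti _ _ _ _ N g); first exact: monomials_exceptE.
move=> a; rewrite gP divisor_except //.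
split=> [[b [db bm ba]]|[b /andP[/eqP db bm] ba]]; exists b => //.
by rewrite db eqxx.
Qed.

Lemma supp_le_deg : (s <= d)%N.
Proof.
rewrite -sum1_card mdegE big_mkcond /=; apply: leq_sum => i _.
by rewrite inE lep1mP; case: (m i).
Qed.

Lemma deg_gt1 : (1 < d)%N. Proof. exact: leq_trans s_gt1 supp_le_deg. Qed.

Lemma supp_le_n : (s <= n)%N.
Proof. by rewrite -[X in (_ <= X)%N](card_ord n); apply: max_card. Qed.

Definition nfaces_over p := #|[set U in faces n p | msupport m \subset U]|.

(** Taking complements, this counts the subsets of size n - p of the complement of
supp(m). *)
Lemma nfaces_overE p : nfaces_over p = if (p < s)%N then 0%N else 'C(n - s, p - s).
Proof.
have [np|pn] := ltnP n p.
  rewrite /nfaces_over (_ : [set U in _ | _] = set0) ?cards0.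
    by case: ifP => // _; rewrite bin_small // ltn_sub2r // (leq_ltn_trans supp_le_n).
  apply/setP => U; rewrite !inE; apply/negP => /andP[/eqP Up _].
  by have := max_card U; rewrite card_ord Up leqNgt np.
have -> : nfaces_over p = 'C(n - s, n - p).
  rewrite /nfaces_over; have <- : #|~: msupport m| = (n - s)%N.
    by rewrite cardsCs setCK card_ord.
  rewrite -cards_draws -(card_imset _ (inv_inj (@setCK _))); apply: eq_card => U.
  rewrite inE; apply/andP/imsetP => [[Up mU]|[V + ->]].
    rewrite inE in Up; exists (~: U); rewrite ?setCK // !inE setCS mU.
    by rewrite cardsCs setCK card_ord (eqP Up) eqxx.
  rewrite !inE => /andP[VC /eqP Vp]; rewrite subsetC VC cardsCs setCK card_ord Vp.
  by rewrite subKn.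
have sn := supp_le_n.
case: ltnP => [ps|sp]; first by rewrite bin_small // ltn_sub2l // (leq_trans ps).
by rewrite -bin_sub ?leq_sub2l // subn_subn_subn.
Qed.

Lemma nfaces_overC p :
  (#|[set U in faces n p | ~~ (msupport m \subset U)]| + nfaces_over p)%N =
  'C(n, p).
Proof.
rewrite -[n in RHS](card_ord n) -card_draws -/(faces n p) addnC.
rewrite -(cardsID [set U : {set 'I_n} | msupport m \subset U] (faces n p)).
by congr (_ + _)%N; apply: eq_card => U; rewrite !inE // andbC.
Qed.

Lemma full_mon0 : ~ full_mon m 0%MM.
Proof. by rewrite /full_mon mdeg0 leqn0 => /eqP d0; have := deg_gt1; rewrite d0. Qed.

Lemma punctured_mon0 : ~ punctured_mon m 0%MM.
Proof. by case=> /full_mon0. Qed.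

Lemma betti_full_00 : betti I 0 0 = 1%N.
Proof.
exact: quotient_dim_uniq (full_betti 0 0)
  (koszul_00 k (@full_mon_upward _ m) full_mon0 (erefl 0)).
Qed.

Lemma betti_punctured_00 : betti Ihat 0 0 = 1%N.
Proof.
exact: quotient_dim_uniq (punctured_betti 0 0)
  (koszul_00 k (@punctured_mon_upward _ m) punctured_mon0 (erefl 0)).
Qed.

Lemma betti_full_0 p q : ~ (p = 0%N /\ q = 0) ->
  (p = 0%N \/ q <> d%:Z + p%:Z - 1) -> betti I p q = 0%N.
Proof.
move=> pq0 pq; apply: quotient_dim_uniq (full_betti p q) _.
have [le|lt] := boolP (d%:Z <= q - p%:Z)%R.
  apply: (koszul_top k (@full_mon_upward _ m)) => a ae; rewrite /full_mon; lia.
apply: (koszul_acyclic k (@full_mon_upward _ m) pq0).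
case: pq => [->|pq]; [by left|right=> a ae]; rewrite /full_mon => da.
by apply: pq; lia.
Qed.

Lemma betti_punctured_0 p q : ~ (p = 0%N /\ q = 0) ->
  (p = 0%N \/ q <> d%:Z + p%:Z - 1) -> q <> d%:Z + p%:Z -> betti Ihat p q = 0%N.
Proof.
move=> pq0 pq pq'; apply: quotient_dim_uniq (punctured_betti p q) _.
have [le|lt] := boolP (d%:Z <= q - p%:Z)%R.
  apply: (koszul_top k (@punctured_mon_upward _ m)) => a ae; split; first lia.
  by move=> am; apply: pq'; move: ae; rewrite am; lia.
apply: (koszul_acyclic k (@punctured_mon_upward _ m) pq0).
case: pq => [->|pq]; [by left|right=> a ae [da _]].
by apply: pq; lia.
Qed.

Lemma betti_punctured_socle p : betti Ihat p (d%:Z + p%:Z) = nfaces_over p.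
Proof.
apply: quotient_dim_uniq (punctured_betti _ _) (koszul_socle k _).
by rewrite PoszD addrC.
Qed.

Lemma betti_linear p :
  (betti I p.+1 (d%:Z + p.+1%:Z - 1) + nfaces_over p =
   betti Ihat p.+1 (d%:Z + p.+1%:Z - 1) + 'C(n, p))%N.
Proof.
have qE : d%:Z + p.+1%:Z - 1 = (p + d)%:Z by lia.
rewrite (koszul_linear qE (full_betti _ _) (punctured_betti _ _)) -(nfaces_overC p).
by rewrite addnAC addnC.
Qed.

(** The Koszul complex has length n. *)
Lemma betti_full_big p q : (n < p)%N -> betti I p q = 0%N.
Proof.
move=> np; apply: quotient_dim_uniq (full_betti p q) _.
apply: quotient_dim0.
  exact: (cycles_mod_subspace q (koszul k n) (@full_mon_upward _ m) p).
move=> w _; apply: ideal_bound; apply/mon_ideal_mx_kcoef => T.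
rewrite /kcoef face_coef_out; first exact: mon_ideal0.
by apply: contraTneq np => <-; rewrite -leqNgt -[X in (_ <= X)%N](card_ord n) max_card.
Qed.

End Values.

Lemma binz_nat a b : binz a%:Z b%:Z = 'C(a, b)%:Z.
Proof. by rewrite /binz lez_nat /=; case: leqP => // ab; rewrite bin_small. Qed.

Lemma binz_neg a b : (b < 0)%R -> binz a b = 0.
Proof. by rewrite /binz; case: ifP => //; lia. Qed.

(** * Generating functions *)

Section Generating.
Notation ZZ := {poly {poly int}}.
Notation t := ('X : ZZ).
Notation u := ('X%:P : ZZ).

Lemma binomial_coef n p : ((1 + t * u) ^+ n)`_p = 'X^p *+ 'C(n, p).
Proof.
have -> : (1 + t * u) ^+ n = \poly_(i < n.+1) ('X^i *+ 'C(n, i)).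
  rewrite exprDn poly_def; apply: eq_bigr => i _.
  by rewrite expr1n mul1r exprMn -mul_polyC polyCMn mulrnAl mulrC -polyC_exp.
rewrite coef_poly ltnS; case: leqP => // np.
by rewrite bin_small.
Qed.

Lemma linear_part_coef d n p j :
  (t * u ^+ d * (1 + t * u) ^+ n)`_p`_j =
  if p is p'.+1 then (j == d + p')%N%:Z * 'C(n, p')%:Z else 0.
Proof.
rewrite -mulrA coefXM; case: p => [|p] /=; first by rewrite coef0.
rewrite -polyC_exp coefCM binomial_coef mulrnAr -exprD.
by rewrite coefMn coefXn; case: (j == _); rewrite ?mul0rn ?mul0r // mul1r -natz.
Qed.

Lemma socle_part_coef d n s p j :
  (t ^+ s * u ^+ (s + d) * (1 + t * u) ^+ (n - s))`_p`_j =
  (j == d + p)%N%:Z * (if (p < s)%N then 0%N else 'C(n - s, p - s))%:Z.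
Proof.
rewrite -mulrA coefXnM; case: ltnP => [ps|sp]; first by rewrite coef0 mulr0.
rewrite -polyC_exp coefCM binomial_coef mulrnAr -exprD.
have -> : (s + d + (p - s) = d + p)%N by lia.
by rewrite coefMn coefXn; case: (j == _); rewrite ?mul0rn ?mul0r // mul1r -natz.
Qed.

End Generating.

Theorem corollary7p5 (k : fieldType) (n d s : nat) (m : 'X_{1..n})
    (hm : mdeg m = d) (hs : #|msupport m| = s) (s_gt1 : (1 < s)%N) :
  let I := ideal_pow (@var_ideal k n) d in
  let Ihat := @monomials_except_ideal k n d m in
  let t : {poly {poly int}} := 'X in
  let u : {poly {poly int}} := 'X%:P in
  [/\ betti Ihat 0 0 = 1%N,
      forall p : nat,
        (betti Ihat p (d%:Z + p%:Z - 1))%:Z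
        = (betti I p (d%:Z + p%:Z - 1))%:Z
          - binz n%:Z (p%:Z - 1) + binz (n%:Z - s%:Z) (n%:Z - p%:Z + 1),
      forall p : nat,
        (betti Ihat p (d%:Z + p%:Z))%:Z = binz (n%:Z - s%:Z) (n%:Z - p%:Z),
      forall (p : nat) (q : int),
        ~ (p = 0%N /\ q = 0) -> q <> d%:Z + p%:Z - 1 -> q <> d%:Z + p%:Z ->
        betti Ihat p q = 0%N
    & exists P Phat : {poly {poly int}},
        [/\ poincare_poly I P, poincare_poly Ihat Phat
          & Phat = P - t * u ^+ d * (1 + t * u) ^+ n
                   + (1 + t) * t ^+ s * u ^+ (s + d) * (1 + t * u) ^+ (n - s)]].
Proof.
subst d s; set d := mdeg m; set s := #|msupport m| in s_gt1 *.
move=> I Ihat t u.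
have d_gt1 : (1 < d)%N := deg_gt1 s_gt1.
have sn : (s <= n)%N := supp_le_n m.
have socle p : binz (n%:Z - s%:Z) (n%:Z - p%:Z) = (nfaces_over m p)%:Z.
  have [pn|np] := leqP p n; last first.
    rewrite binz_neg; last by lia.
    by rewrite nfaces_overE bin_small ?if_same // ltn_sub2r // (leq_ltn_trans sn).
  rewrite !subzn // binz_nat nfaces_overE -/s; case: ltnP => [ps|sp].
    by rewrite bin_small // ltn_sub2l // (leq_trans ps).
  by rewrite -bin_sub ?leq_sub2l // subn_subn_subn.
have full_0 p q : ~ (p = 0%N /\ q = 0) ->
    (p = 0%N \/ q <> d%:Z + p%:Z - 1) -> betti I p q = 0%N.
  exact: betti_full_0.
have punctured_0 p q : ~ (p = 0%N /\ q = 0) -> (p = 0%N \/ q <> d%:Z + p%:Z - 1) ->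
    q <> d%:Z + p%:Z -> betti Ihat p q = 0%N.
  exact: betti_punctured_0.
have linear p : (betti Ihat p.+1 (d%:Z + p.+1%:Z - 1))%:Z =
    (betti I p.+1 (d%:Z + p.+1%:Z - 1))%:Z - 'C(n, p)%:Z + (nfaces_over m p)%:Z.
  by have := betti_linear k s_gt1 p; rewrite -/d -/I -/Ihat; lia.
split.
- exact: betti_punctured_00.
- case=> [|p].
    rewrite full_0; [|lia|by left]; rewrite punctured_0; [|lia|by left|lia].
    rewrite binz_neg; last by lia.
    by rewrite /binz; case: ifP => //; lia.
  rewrite linear; congr (_ - _ + _).
    by rewrite -binz_nat; congr (binz _ _); lia.
  by rewrite -socle; congr (binz _ _); lia.
- by move=> p; rewrite socle -(betti_punctured_socle k s_gt1).
- by move=> p q pq0 pq pq'; apply: punctured_0 => //; right.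
(* The resolution of S/I is linear: apart from p = 0, only q = d + p - 1 occurs. *)
pose P : {poly {poly int}} := \poly_(p < n.+2)
  if p is 0 then 1 else (betti I p (d%:Z + p%:Z - 1))%:Z *: 'X ^+ (d + p).-1.
have PE p (j : nat) : P`_p`_j = (betti I p j)%:Z.
  rewrite coef_poly; case: ltnP => [pn|np]; last first.
    by rewrite coef0 betti_full_big // ltnW.
  case: p pn => [|p] pn.
    rewrite coef1; case: j => [|j]; first by rewrite betti_full_00.
    by rewrite full_0 //; [case | left].
  rewrite coefZ coefXn; case: (j =P (d + p.+1).-1) => [->|jp].
    rewrite mulr1; congr ((betti I _ _)%:Z); lia.
  by rewrite mulr0 full_0 //; [case | right; lia].
have P_neg p (j : nat) : betti I p (Negz j) = 0%N.
  by apply: full_0; [case | right; lia].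
exists P, (P - t * u ^+ d * (1 + t * u) ^+ n
             + (1 + t) * t ^+ s * u ^+ (s + d) * (1 + t * u) ^+ (n - s)).
split=> //.
  by move=> p [j|j]; rewrite ?PE ?P_neg.
move=> p [j|j]; last by rewrite punctured_0 //; [case | right; lia].
set E := t ^+ s * u ^+ (s + d) * (1 + t * u) ^+ (n - s).
have -> : (1 + t) * t ^+ s * u ^+ (s + d) * (1 + t * u) ^+ (n - s) = E + t * E.
  by rewrite /E !mulrA mulrDl mul1r !mulrDl.
have EE i l : E`_i`_l = (l == d + i)%N%:Z * (nfaces_over m i)%:Z.
  by rewrite /E socle_part_coef nfaces_overE.
have LE i l : (t * u ^+ d * (1 + t * u) ^+ n)`_i`_l =
    if i is i'.+1 then (l == d + i')%N%:Z * 'C(n, i')%:Z else 0.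
  exact: linear_part_coef.
rewrite !(coefD, coefN) PE LE EE coefXM.
case: p => [|p] /=.
  rewrite coef0 subr0 addr0 nfaces_overE -/s (leq_trans _ s_gt1) // mulr0 addr0.
  case: j => [|j]; first by rewrite betti_full_00 // betti_punctured_00.
  rewrite full_0; [|by case|by left].
  case: (j.+1 =P d) => [jd|jd].
    have := betti_punctured_socle k s_gt1 0; rewrite -/d -/Ihat addr0 -jd => ->.
    by rewrite nfaces_overE -/s (leq_trans _ s_gt1).
  rewrite punctured_0 //; [by case|by left|lia].
rewrite EE; case: (j =P d + p)%N => [jdp|jdp].
  rewrite (_ : (j == d + p.+1)%N = false); last by lia.
  have -> : j%:Z = d%:Z + p.+1%:Z - 1 by lia.
  by rewrite linear; lia.
rewrite full_0; [|by case|right; lia].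
case: (j =P d + p.+1)%N => [jdp'|jdp'].
  have -> : j%:Z = d%:Z + p.+1%:Z by lia.
  by rewrite (betti_punctured_socle k s_gt1); lia.
by rewrite punctured_0; [|case|right; lia|lia].
Qed.
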